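(* For $K, C \in \mathcal{K}^n$, we have $$\frac{s(K)+1}{s(C)+1}\max\left\{\frac{s(C)}{s(K)},1\right\} \le \left(\max_{A \in GL_n(\mathbb{R})}\frac{w(AC,K)}{2R(AC,K)}\right)^{-1} = \min_{A \in GL_n(\mathbb{R})}\frac{D(AK,C)}{2r(AK,C)} \le d_{GR}(K,C).$$ Equality in the lower bound (the first inequality) is attained if there exists $\lambda \in [0,1]$ such that $K = C - \lambda C$ or $C = K - \lambda K$. Equality in the upper bound (the last inequality) is attained if both $K$ and $C$ are symmetric or if $C$ is a parallelotope. In particular, the lower bound is best possible for any prescribed $s(K), s(C) \in [1,n]$ (i.e., for all $s_1,s_2 \in [1,n]$ there exist $K,C\in\mathcal{K}^n$ with $s(K)=s_1$, $s(C)=s_2$ attaining equality in the lower bound), and the upper bound is best possible for any prescribed $d_{GR}(K,C) \in [1,n]$ (i.e., for every $d\in[1,n]$ there exist $K,C \in \mathcal{K}^n$ with $d_{GR}(K,C)=d$ attaining equality in the upper bound).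
   Context: $\mathcal{K}^n$ is the family of convex bodies in $\mathbb{R}^n$, i.e., compact convex sets with non-empty interior. $X + Y$ is the Minkowski sum, $\rho X = \{\rho x : x \in X\}$ for $\rho\in\mathbb{R}$, $-X = (-1)X$, and $X - \lambda Y = X + (-\lambda) Y$. $K$ is (centrally) symmetric if $K - c = c - K$ for some $c \in \mathbb{R}^n$. Write $X \subset_t Y$ if some translate of $X$ is a subset of $Y$. The support function is $h_X(a) = \max\{a^T x : x \in X\}$. The Minkowski asymmetry $s(K)$ is the smallest $\rho \ge 0$ with $-K \subset_t \rho K$; it takes values in $[1,n]$. For $K, C \in \mathcal{K}^n$ define $$R(K,C) = \inf\{\rho \ge 0 : K \subset_t \rho C\}, \quad r(K,C) = \sup\{\rho \ge 0 : \rho C \subset_t K\},$$ $$w(K,C) = \inf_{a \in \mathbb{R}^n\setminus\{0\}} 2\,\frac{h_K(a)+h_K(-a)}{h_C(a)+h_C(-a)}, \quad D(K,C) = \sup_{a \in \mathbb{R}^n\setminus\{0\}} 2\,\frac{h_K(a)+h_K(-a)}{h_C(a)+h_C(-a)}.$$ The Grünbaum distance is $d_{GR}(K,C) = \inf\{|\rho| : C \subset_t AK \subset_t \rho C,\ A \in GL_n(\mathbb{R}),\ \rho \in \mathbb{R}\}$; it always satisfies $d_{GR}(K,C)\le n$. *)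

(* Defs.v *)
From HB Require Import structures.
From mathcomp Require Import all_boot all_order all_algebra.
From mathcomp Require Import all_classical all_reals all_analysis.
Set Implicit Arguments.
Unset Strict Implicit.
Unset Printing Implicit Defensive.
Import Order.TTheory GRing.Theory Num.Theory.
Import numFieldNormedType.Exports.
Local Open Scope classical_set_scope.
Local Open Scope ring_scope.

(* Points of R^n are row vectors 'rV[R]_n, on which matrices act on the right.

   [sup] and [inf] on R return 0 on sets that are empty or unbounded on the
   relevant side.  For convex bodies in dimension n >= 1 every set to which
   they are applied below is nonempty and bounded on that side, so they are
   the genuine supremum and infimum. *)

Section ConvexBodies.
Variables (R : realType) (n : nat).
Implicit Types (X Y K C : set 'rV[R]_n) (a : 'rV[R]_n) (rho : R).

Definition convex_body K : Prop :=
  [/\ compact K, convex_set K & interior K !=set0].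

Definition translate (t : 'rV[R]_n) X : set 'rV[R]_n := [set x + t | x in X].

Definition minkowski_sum X Y : set 'rV[R]_n :=
  [set z | exists2 x, X x & exists2 y, Y y & z = x + y].

Definition dilate rho X : set 'rV[R]_n := [set rho *: x | x in X].

Definition linear_image (A : 'M[R]_n) X : set 'rV[R]_n := [set x *m A | x in X].

Definition subset_t X Y : Prop := exists t : 'rV[R]_n, translate t X `<=` Y.

Definition centrally_symmetric K : Prop :=
  exists c : 'rV[R]_n, [set x - c | x in K] = [set c - x | x in K].

Definition parallelotope C : Prop :=
  exists (A : 'M[R]_n) (t : 'rV[R]_n), A \in unitmx /\
    C = translate t (linear_image A [set x | forall i, 0 <= x 0 i <= 1]).

Definition support_function X a : R := sup [set (a *m x^T) 0 0 | x in X].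

Definition asymmetry K : R :=
  inf [set rho | 0 <= rho /\ subset_t (dilate (-1) K) (dilate rho K)].

Definition circumradius K C : R :=
  inf [set rho | 0 <= rho /\ subset_t K (dilate rho C)].

Definition inradius K C : R :=
  sup [set rho | 0 <= rho /\ subset_t (dilate rho C) K].

Definition breadth K a : R := support_function K a + support_function K (- a).

Definition width K C : R :=
  inf [set 2 * (breadth K a / breadth C a) | a in [set a | a != 0]].

Definition diameter K C : R :=
  sup [set 2 * (breadth K a / breadth C a) | a in [set a | a != 0]].

Definition grunbaum_distance K C : R :=
  inf [set `|rho| | rho in [set rho | exists A : 'M[R]_n,
    [/\ A \in unitmx, subset_t C (linear_image A K) &
        subset_t (linear_image A K) (dilate rho C)]]].

Definition width_ratios K C : set R :=
  [set width (linear_image A C) K / (2 * circumradius (linear_image A C) K)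
    | A in [set A | A \in unitmx]].

Definition diameter_ratios K C : set R :=
  [set diameter (linear_image A K) C / (2 * inradius (linear_image A K) C)
    | A in [set A | A \in unitmx]].

Definition lower_bound K C : R :=
  (asymmetry K + 1) / (asymmetry C + 1) * Num.max (asymmetry C / asymmetry K) 1.

End ConvexBodies.

Definition is_max (R : realType) (S : set R) (m : R) : Prop := S m /\ ubound S m.

Definition is_min (R : realType) (S : set R) (m : R) : Prop := S m /\ lbound S m.

(* Main.v *)
Require Import Defs.
From HB Require Import structures.
From mathcomp Require Import all_boot all_order all_algebra.
From mathcomp Require Import all_classical all_reals all_analysis.
From mathcomp Require Import ring lra.
Import Order.TTheory GRing.Theory Num.Theory.
Import numFieldNormedType.Exports.
Local Open Scope classical_set_scope.
Local Open Scope ring_scope.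

(** Write h_X for the support function, b_X(a) = h_X(a) + h_X(-a) for the
    breadth, and s for the Minkowski asymmetry.  A compact convex set is the
    intersection of its supporting half-spaces ([mem_of_dot_le_support]), so for
    rho >= 0 an inclusion X ⊂_t rho Y amounts to a vector t with
    h_X(a) + <a,t> <= rho h_Y(a) for all a (the predicate [fits]).  All
    inclusions are handled in this form, where a change of coordinates is a
    substitution a |-> a A^T and a scaling is a multiplication.

    Both optimisation problems are the same one.  Since r(Y,X) = 1/R(X,Y),
    D(K,C) = 4/w(C,K), and w and R are unchanged when one linear map acts on both
    bodies, the diameter quotient at A is the inverse of the width quotient at
    A^-1.  After rescaling the image of C to circumradius 1, some width quotient
    is at least omega > 0 exactly when [admissible C K omega] holds: some affine
    image CB + t lies in K and still has breadth at least omega b_K in every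
    direction.  The pairs (B,t) that map C into K form a compact set, because C
    contains a ball and K is compact, so a largest admissible M exists; it is
    positive, which forces the optimal B to be invertible.  Hence M is the maximum
    of the width quotients and 1/M the minimum of the diameter quotients.

    Lower bound.  Let omega be admissible with C ⊂_t K after the linear map.
    Then omega (K - K) ⊂ C - C ⊂_t (s(C)+1) C ⊂_t (s(C)+1) K, and cancelling one
    copy of K gives omega (s(K)+1) <= s(C)+1.  Likewise
    omega (1 + 1/s(K)) C ⊂_t omega (1 + 1/s(K)) K ⊂_t omega (K - K) ⊂ C - C, and
    cancelling one copy of C gives omega (1 + 1/s(K)) <= 1 + 1/s(C).  These are
    the two terms of the maximum.  If K = C - lambda C or C = K - lambda K, a
    homothety B already yields an admissible omega that meets the bound; this
    uses s(C - lambda C) = (s(C) + lambda)/(1 + lambda s(C)).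

    Upper bound.  From C ⊂_t AK ⊂_t rho C the map A^-1 makes 1/|rho|
    admissible.  Conversely the optimal B gives b_{AK} <= b_C / M with
    A = B^-1; if both bodies are symmetric, or if C is a parallelotope, this
    comparison of breadths implies the inclusion AK ⊂_t M^-1 C.

    Sharpness.  The unit cube cut by the half-space of points with coordinate
    sum at most n/d has asymmetry d and lies between [0,1/d]^n and [0,1]^n.  Its
    Grünbaum distance to the cube is therefore d, because that distance is at
    least the asymmetry when the second body is symmetric.  The bodies
    C - lambda C, for C a cut cube, take every asymmetry between 1 and s(C), which
    gives equality in the lower bound for each pair of asymmetries. *)

(** * Inner product and topology of matrices *)

(** The pairing in the definition of [support_function]. *)
Definition dot {R : realType} {n : nat} (a x : 'rV[R]_n) : R := (a *m x^T) 0 0.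

Section DotProduct.
Context {R : realType} {n : nat}.
Implicit Types (a b x y : 'rV[R]_n) (A : 'M[R]_n).

Lemma dotE a x : dot a x = \sum_j a 0 j * x 0 j.
Proof. by rewrite /dot mxE; apply: eq_bigr => j _; rewrite mxE. Qed.

Lemma dotC a x : dot a x = dot x a.
Proof. by rewrite !dotE; apply: eq_bigr => j _; rewrite mulrC. Qed.

Lemma dotDl a b x : dot (a + b) x = dot a x + dot b x.
Proof. by rewrite /dot mulmxDl mxE. Qed.

Lemma dotZl k a x : dot (k *: a) x = k * dot a x.
Proof. by rewrite /dot -scalemxAl mxE. Qed.

Lemma dotNl a x : dot (- a) x = - dot a x.
Proof. by rewrite -scaleN1r dotZl mulN1r. Qed.

Lemma dot0l x : dot 0 x = 0.
Proof. by rewrite /dot mul0mx mxE. Qed.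

Lemma dotDr a x y : dot a (x + y) = dot a x + dot a y.
Proof. by rewrite dotC dotDl !(dotC _ a). Qed.

Lemma dotZr k a x : dot a (k *: x) = k * dot a x.
Proof. by rewrite dotC dotZl dotC. Qed.

Lemma dotNr a x : dot a (- x) = - dot a x.
Proof. by rewrite dotC dotNl dotC. Qed.

(** Moves a linear map from the points to the directions; this is how the
    support function of a linear image is computed. *)
Lemma dot_mulmx a x A : dot a (x *m A) = dot (a *m A^T) x.
Proof. by rewrite /dot trmx_mul mulmxA. Qed.

Lemma dot_delta i x : dot (delta_mx 0 i) x = x 0 i.
Proof.
rewrite dotE (bigD1 i) //= mxE !eqxx mul1r big1 ?addr0 // => j /negbTE ji.
by rewrite mxE ji mul0r.
Qed.

Lemma dot_gt0 a : a != 0 -> 0 < dot a a.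
Proof.
move=> /rV0Pn[i ai]; rewrite dotE (bigD1 i) //= ltr_wpDr //.
  by apply: sumr_ge0 => j _; rewrite -expr2 sqr_ge0.
by rewrite -expr2 exprn_even_gt0.
Qed.

End DotProduct.

Section MatrixTopology.
Context {R : realType}.

(** The topology of matrices is the product topology of the entries. *)
Lemma mx_continuous {T : topologicalType} {m p : nat} (f : T -> 'M[R]_(m, p)) :
  (forall i j, continuous (fun x => f x i j)) -> continuous f.
Proof.
move=> fc x A [P fP PA].
have : \forall y \near x, forall i j, P i j (f y i j).
  by apply: filter_forall => i; apply: filter_forall => j; exact: fc (fP i j).
by apply: filterS => y; exact: PA.
Qed.

Lemma coord_comp_continuous {T : topologicalType} {m p : nat}
    (f : T -> 'M[R]_(m, p)) i j :
  continuous f -> continuous (fun x => f x i j).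
Proof.
move=> fc x; apply: (@continuous_comp _ _ _ f (fun A : 'M[R]_(m, p) => A i j)).
  exact: fc.
exact: coord_continuous.
Qed.

Lemma mulmx_continuous {T : topologicalType} {m p q : nat}
    (f : T -> 'M[R]_(m, p)) (g : T -> 'M[R]_(p, q)) :
  continuous f -> continuous g -> continuous (fun x => f x *m g x).
Proof.
move=> fc gc; apply: mx_continuous => i j.
rewrite (_ : (fun _ => _) = fun x => \sum_k f x i k * g x k j); last first.
  by apply/funext => x; rewrite mxE.
have addc : continuous (fun z : R * R => z.1 + z.2) by exact: add_continuous.
apply: (continuous_big addc) => k _ x.
by apply: cvgM; exact: coord_comp_continuous.
Qed.

Lemma trmx_continuous {T : topologicalType} {m p : nat}
    (f : T -> 'M[R]_(m, p)) :
  continuous f -> continuous (fun x => (f x)^T).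
Proof.
move=> fc; apply: mx_continuous => i j.
rewrite (_ : (fun _ => _) = fun x => f x j i); last first.
  by apply/funext => x; rewrite mxE.
exact: coord_comp_continuous.
Qed.

Lemma dot_continuous {T : topologicalType} {n : nat} (f g : T -> 'rV[R]_n) :
  continuous f -> continuous g -> continuous (fun x => dot (f x) (g x)).
Proof.
move=> fc gc; apply: (@coord_comp_continuous _ _ _ (fun x => f x *m (g x)^T)).
by apply: mulmx_continuous => //; exact: trmx_continuous.
Qed.

Lemma coord_le_norm {m p : nat} (A : 'M[R]_(m, p)) i j : `|A i j| <= `|A|.
Proof.
rewrite [leRHS]/Num.norm /= mx_normrE.
exact: (le_bigmax _ (fun ij : 'I_m * 'I_p => `|A ij.1 ij.2|) (i, j)).
Qed.

Lemma mx_norm_le {m p : nat} (A : 'M[R]_(m, p)) e :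
  0 <= e -> (forall i j, `|A i j| <= e) -> `|A| <= e.
Proof.
by move=> e0 Ae; rewrite /Num.norm /= mx_normrE; apply/bigmax_leP; split=> /=.
Qed.

(** Heine-Borel for rectangular matrices, transported from row vectors along
    [vec_mx], which does not increase the norm and is continuous. *)
Lemma mx_ball_compact {m p : nat} (e : R) :
  compact [set A : 'M[R]_(m, p) | `|A| <= e].
Proof.
have [e0|e0] := ltP e 0.
  suff -> : [set A : 'M[R]_(m, p) | `|A| <= e] = set0 by exact: compact0.
  apply/seteqP; split => // A /= Ae.
  by have := lt_le_trans (le_lt_trans Ae e0) (normr_ge0 A); rewrite ltxx.
have cs : compact [set v : 'rV[R]_(m * p) | `|v| <= e].
  apply: bounded_closed_compact.
    by exists e; split; rewrite ?num_real // => M eM v /= /le_trans; apply; exact: ltW.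
  apply: (@preimage_closed _ _ (fun v : 'rV[R]_(m * p) => `|v|) [set x | x <= e]).
    by move=> x _; exact: norm_continuous.
  exact: closed_le.
have -> : [set A : 'M[R]_(m, p) | `|A| <= e] =
          vec_mx @` [set v : 'rV[R]_(m * p) | `|v| <= e].
  apply/seteqP; split=> [A /= Ae|_ [v /= ve <-]].
    exists (mxvec A); last exact: mxvecK.
    by apply: mx_norm_le => // i j; case/mxvec_indexP: j => k l;
       rewrite ord1 mxvecE; exact: le_trans (coord_le_norm _ _ _) Ae.
  apply: mx_norm_le => // i j; rewrite mxE.
  exact: le_trans (coord_le_norm _ _ _) ve.
apply: continuous_compact cs; apply: continuous_subspaceT.
apply: mx_continuous => i j.
rewrite (_ : (fun _ => _) = fun v : 'rV[R]_(m * p) => v 0 (mxvec_index i j)).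
  exact: coord_continuous.
by apply/funext => v; rewrite mxE.
Qed.

End MatrixTopology.

(** * Support functions *)

Section SupportFunction.
Context {R : realType} {n : nat}.
Implicit Types (X Y : set 'rV[R]_n) (a b x p t : 'rV[R]_n) (A : 'M[R]_n).

Lemma convex_setP X : convex_set X <-> forall x y (k : R), 0 <= k -> k <= 1 ->
  X x -> X y -> X (k *: x + (1 - k) *: y).
Proof.
split=> [cX x y k k0 k1 Xx Xy|cX x y k /set_mem Xx /set_mem Xy].
  by have := cX x y (Itv01 k0 k1) (mem_set Xx) (mem_set Xy); rewrite inE.
by rewrite inE; apply: (cX x y k%:num).
Qed.

Lemma support_has_sup X a :
  compact X -> X !=set0 -> has_sup [set dot a x | x in X].
Proof.
move=> cX X0; apply: compact_has_sup; first exact: image_nonempty.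
apply: continuous_compact cX; apply: continuous_subspaceT.
by apply: (dot_continuous (cst a) id) => x; [exact: cst_continuous|exact: cvg_id].
Qed.

Lemma dot_le_support X a x : compact X -> X x -> dot a x <= support_function X a.
Proof.
move=> cX Xx; apply: sup_upper_bound; last by exists x.
by apply: support_has_sup => //; exists x.
Qed.

Lemma support_le X a m :
  X !=set0 -> (forall x, X x -> dot a x <= m) -> support_function X a <= m.
Proof.
move=> X0 Xm; apply: ge_sup; first exact: image_nonempty.
by move=> _ [x Xx <-]; exact: Xm.
Qed.

Lemma supportD_le X a b : compact X -> X !=set0 ->
  support_function X (a + b) <= support_function X a + support_function X b.
Proof.
move=> cX X0; apply: support_le => // x Xx.
by rewrite dotDl lerD // dot_le_support.
Qed.

Lemma supportZ X k a : compact X -> X !=set0 -> 0 <= k ->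
  support_function X (k *: a) = k * support_function X a.
Proof.
move=> cX X0; rewrite le_eqVlt => /predU1P[<-|k0].
  rewrite scale0r mul0r; apply/eqP; rewrite eq_le; case: X0 => x Xx.
  apply/andP; split.
    by apply: support_le => [|y _]; [exists x|rewrite dot0l].
  by apply: le_trans (dot_le_support _ _ _ cX Xx); rewrite dot0l.
apply/eqP; rewrite eq_le; apply/andP; split.
  by apply: support_le => // x Xx; rewrite dotZl ler_pM2l // dot_le_support.
rewrite mulrC -ler_pdivlMr //; apply: support_le => // x Xx.
by rewrite ler_pdivlMr // mulrC -dotZl dot_le_support.
Qed.

(** Both sides are suprema of the same set of reals. *)
Lemma support_linear_image A X a :
  support_function (linear_image A X) a = support_function X (a *m A^T).
Proof.
rewrite /support_function /linear_image image_comp; congr sup.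
by apply: eq_imagel => x _ /=; rewrite -!/(dot _ _) dot_mulmx.
Qed.

Lemma support_dilate k X a :
  support_function (dilate k X) a = support_function X (k *: a).
Proof.
rewrite /support_function /dilate image_comp; congr sup.
by apply: eq_imagel => x _ /=; rewrite -!/(dot _ _) dotZl dotZr.
Qed.

Lemma support_minkowski X Y a : compact X -> X !=set0 -> compact Y -> Y !=set0 ->
  support_function (minkowski_sum X Y) a =
  support_function X a + support_function Y a.
Proof.
move=> cX [x0 Xx0] cY [y0 Yy0]; apply/eqP; rewrite eq_le; apply/andP; split.
  apply: support_le => [|_ [x Xx [y Yy ->]]].
    by exists (x0 + y0), x0 => //; exists y0.
  by rewrite dotDr lerD // dot_le_support.
have ub : has_ubound [set dot a x | x in minkowski_sum X Y].
  exists (support_function X a + support_function Y a) => _ [_ [x Xx [y Yy ->]] <-].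
  by rewrite dotDr lerD // dot_le_support.
rewrite -lerBrDr; apply: support_le => [|x Xx]; first by exists x0.
rewrite lerBrDr -lerBrDl; apply: support_le => [|y Yy]; first by exists y0.
rewrite lerBrDl -dotDr; apply: ub_le_sup => //.
by exists (x + y) => //; exists x => //; exists y.
Qed.

(** Separation of a point p from a compact convex set Y.  If x0 is the point of
    Y nearest to p and x0 <> p, then the direction p - x0 violates the hypothesis:
    moving from x0 towards a point y of Y with <p - x0, y> > <p - x0, x0> would
    decrease the distance to p. *)
Lemma mem_of_dot_le_support Y p : compact Y -> convex_set Y -> Y !=set0 ->
  (forall a, dot a p <= support_function Y a) -> Y p.
Proof.
move=> cY /convex_setP cvY Y0 Yp.
have fc : continuous (fun x => dot (x - p) (x - p)).
  have pc : continuous (fun x : 'rV[R]_n => x - p).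
    by move=> x; apply: continuousB; [exact: cvg_id|exact: cst_continuous].
  exact: dot_continuous.
have [x0 /set_mem Yx0 x0min] :=
  EVT_min_rV Y0 cY (continuous_subspaceT fc).
have [/eqP|xp] := eqVneq (p - x0) 0; first by rewrite subr_eq0 => /eqP ->.
exfalso; have := dot_gt0 _ xp; rewrite dotDr dotNr subr_gt0 ltNge => /negP; apply.
apply: le_trans (Yp (p - x0)) _; apply: support_le => // y Yy.
rewrite leNgt; apply/negP => lt_y.
set c := dot (p - x0) (y - x0); set d := dot (y - x0) (y - x0).
have c_gt0 : 0 < c by rewrite /c [X in dot _ X]addrC dotDr dotNr addrC subr_gt0.
have d_ge0 : 0 <= d.
  have [yx|/dot_gt0/ltW//] := eqVneq (y - x0) 0.
  by rewrite /d yx dot0l.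
(* The squared distance to p at x0 + k (y - x0) is |p - x0|^2 - 2kc + k^2 d, so any
   k with kd < 2c shortens it. *)
pose k := c / (c + d).
have cd_gt0 : 0 < c + d by rewrite ltr_wpDr.
have k0 : 0 < k by rewrite divr_gt0.
have k1 : k <= 1 by rewrite ler_pdivrMr // mul1r lerDl.
have := x0min _ (mem_set (cvY _ _ _ (ltW k0) k1 Yy Yx0)).
have -> : k *: y + (1 - k) *: x0 - p = k *: (y - x0) - (p - x0).
  by rewrite scalerBl scale1r scalerBr opprB; apply/rowP => i; rewrite !mxE; ring.
have -> : dot (k *: (y - x0) - (p - x0)) (k *: (y - x0) - (p - x0)) =
  dot (x0 - p) (x0 - p) + k * (k * d - 2 * c).
  rewrite -(opprB p x0) !(dotDr, dotDl, dotNr, dotNl, dotZr, dotZl, opprK).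
  rewrite /c /d !(dotDr, dotDl, dotNr, dotNl, opprK).
  by rewrite (dotC x0 p) (dotC y p) (dotC y x0); ring.
rewrite lerDl pmulr_rge0 // leNgt => /negP; apply.
rewrite /k subr_lt0 mulrAC ltr_pdivrMr //; nra.
Qed.

(** The converse implication is separation, applied to every translated point. *)
Lemma subset_tP X Y : compact X -> X !=set0 ->
  compact Y -> convex_set Y -> Y !=set0 ->
  subset_t X Y <->
  exists t, forall a, support_function X a + dot a t <= support_function Y a.
Proof.
move=> cX X0 cY cvY Y0; split=> -[t tXY]; exists t.
  move=> a; rewrite -lerBrDr; apply: support_le => // x Xx.
  rewrite lerBrDr -dotDr; apply: dot_le_support => //.
  by apply: tXY; exists x.
move=> _ [x Xx <-]; apply: mem_of_dot_le_support => // a; rewrite dotDr.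
by apply: le_trans (tXY a); rewrite lerD2r dot_le_support.
Qed.

End SupportFunction.

(** * Convex bodies *)

Section ConvexBodies.
Context {R : realType} {n : nat}.
Implicit Types (X Y C K : set 'rV[R]_n) (a b x p t v : 'rV[R]_n) (A : 'M[R]_n).

Lemma body_compact K : convex_body K -> compact K.
Proof. by case. Qed.

Lemma body_convex K : convex_body K -> convex_set K.
Proof. by case. Qed.

Lemma body_nonempty K : convex_body K -> K !=set0.
Proof. by case=> _ _ [x /interior_subset Kx]; exists x. Qed.

Lemma compact_norm_le X : compact X ->
  exists2 m : R, 0 < m & forall x, X x -> `|x| <= m.
Proof.
move=> /compact_bounded /ex_strict_bound_gt0[m m0 Xm].
by exists m => // x Xx; apply: ltW; exact: Xm.
Qed.

Lemma body_ball C : convex_body C ->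
  exists c, exists2 e : R, 0 < e & forall v, `|v| <= 1 -> C (c + e *: v).
Proof.
case=> _ _ [c] /nbhs_normP[/= r r0 rC]; exists c, (r / 2).
  by rewrite divr_gt0.
move=> v v1; apply: rC => /=.
rewrite opprD addrA subrr add0r normrN normrZ gtr0_norm ?divr_gt0 //.
by rewrite mulrC; nra.
Qed.

(** The interior point of C can be moved both ways along a. *)
Lemma breadth_gt0 C a : convex_body C -> a != 0 -> 0 < breadth C a.
Proof.
move=> bC a0; have cC := body_compact _ bC.
have [c [e e0 Ce]] := body_ball _ bC.
pose v := `|a|^-1 *: a.
have v1 : `|v| <= 1 by rewrite normrZ normfV normr_id mulVf ?normr_eq0.
have Hp := dot_le_support _ a _ cC (Ce v v1).
have vN1 : `|- v| <= 1 by rewrite normrN.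
have Hn := dot_le_support _ (- a) _ cC (Ce (- v) vN1).
apply: lt_le_trans (lerD Hp Hn).
rewrite !(dotDr, dotNl, dotZr, dotNr) opprD !mulrN opprK addrACA subrr add0r.
have : 0 < e * (`|a|^-1 * dot a a).
  by rewrite !mulr_gt0 ?dot_gt0 // invr_gt0 normr_gt0.
lra.
Qed.

(** Scale a ball inside C up to the size of a ball that contains X. *)
Lemma compact_subset_t X C : compact X -> convex_body C ->
  exists2 rho : R, 0 < rho & subset_t X (dilate rho C).
Proof.
move=> /compact_norm_le[m m0 Xm] /body_ball[c [e e0 Ce]].
exists (m / e); first exact: divr_gt0.
exists ((m / e) *: c) => _ [x Xx <-].
exists (c + e *: (m^-1 *: x)).
  by apply: Ce; rewrite normrZ normfV gtr0_norm // mulrC ler_pdivrMr // mul1r Xm.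
rewrite scalerDr addrC !scalerA; congr (_ + _).
by rewrite divfK ?gt_eqF // divff ?gt_eqF // scale1r.
Qed.

Lemma linear_image_compact A X : compact X -> compact (linear_image A X).
Proof.
apply: continuous_compact; apply: continuous_subspaceT.
by apply: (mulmx_continuous id (cst A)) => x; [exact: cvg_id|exact: cst_continuous].
Qed.

Lemma linear_image_convex A X : convex_set X -> convex_set (linear_image A X).
Proof.
move=> /convex_setP cX; apply/convex_setP => _ _ k k0 k1 [x Xx <-] [y Xy <-].
exists (k *: x + (1 - k) *: y); first exact: cX.
by rewrite mulmxDl -!scalemxAl.
Qed.

(** The image has interior points because it is the preimage of K under the
    continuous inverse map. *)
Lemma convex_body_linear_image A K : A \in unitmx ->
  convex_body K -> convex_body (linear_image A K).
Proof.
move=> uA [cK vK [c Kc]]; split.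
- exact: linear_image_compact.
- exact: linear_image_convex.
- exists (c *m A).
  have -> : linear_image A K = (fun x => x *m invmx A) @^-1` K.
    apply/seteqP; split=> [_ [x Kx <-] /=|x /= Kx]; first by rewrite mulmxK.
    by exists (x *m invmx A) => //; rewrite mulmxKV.
  have ctn : continuous (fun x : 'rV[R]_n => x *m invmx A).
    apply: (mulmx_continuous id (cst (invmx A))) => x; first exact: cvg_id.
    exact: cst_continuous.
  by apply: ctn; rewrite mulmxK.
Qed.

Lemma dilateE k X : dilate k X = linear_image k%:M X.
Proof. by apply: eq_imagel => x _; rewrite mul_mx_scalar. Qed.

Lemma convex_body_dilate k K : k != 0 -> convex_body K -> convex_body (dilate k K).
Proof.
move=> k0; rewrite dilateE; apply: convex_body_linear_image.
by rewrite unitmxE det_scalar unitfE expf_neq0.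
Qed.

Lemma minkowski_compact X Y : compact X -> compact Y -> compact (minkowski_sum X Y).
Proof.
move=> cX cY.
have -> : minkowski_sum X Y = (fun z : 'rV[R]_n * 'rV[R]_n => z.1 + z.2) @` (X `*` Y).
  apply/seteqP; split=> [_ [x Xx [y Yy ->]]|_ [[x y] [/= Xx Yy] <-]].
    by exists (x, y).
  by exists x => //; exists y.
apply: continuous_compact; last exact: compact_setX.
by apply: continuous_subspaceT; exact: add_continuous.
Qed.

Lemma minkowski_convex X Y :
  convex_set X -> convex_set Y -> convex_set (minkowski_sum X Y).
Proof.
move=> /convex_setP cX /convex_setP cY; apply/convex_setP.
move=> _ _ k k0 k1 [x Xx [y Yy ->]] [x' Xx' [y' Yy' ->]].
exists (k *: x + (1 - k) *: x'); first exact: cX.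
exists (k *: y + (1 - k) *: y'); first exact: cY.
by rewrite !scalerDr addrACA.
Qed.

Lemma convex_body_minkowski C Y : convex_body C ->
  compact Y -> convex_set Y -> Y !=set0 -> convex_body (minkowski_sum C Y).
Proof.
move=> [cC vC [c Cc]] cY vY [y Yy]; split.
- exact: minkowski_compact.
- exact: minkowski_convex.
- exists (c + y).
  have sc : continuous (fun x : 'rV[R]_n => x - y).
    by move=> x; apply: continuousB; [exact: cvg_id|exact: cst_continuous].
  have : nbhs (c + y - y) C by rewrite addrK.
  move=> /(sc (c + y)) Cxy; rewrite /interior /=.
  apply: (@filterS _ _ _ ((fun x => x - y) @^-1` C)); last exact: Cxy.
  move=> x Cx; exists (x - y) => //; exists y => //.
  by rewrite subrK.
Qed.

(** The support function is Lipschitz, being subadditive and bounded by a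
    multiple of the norm. *)
Lemma support_continuous X : compact X -> X !=set0 -> continuous (support_function X).
Proof.
move=> cX X0; have [m m0 Xm] := compact_norm_le _ cX.
pose L := n%:R * m + 1.
have L0 : 0 < L by rewrite ltr_wpDl // mulr_ge0 // ltW.
have lip v : support_function X v <= L * `|v|.
  apply: support_le => // x Xx; rewrite dotE.
  apply: (@le_trans _ _ (\sum_(j < n) m * `|v|)).
    apply: ler_sum => j _; apply: le_trans (ler_norm _) _.
    rewrite normrM mulrC ler_pM // ?coord_le_norm //.
    exact: le_trans (coord_le_norm _ _ _) (Xm _ Xx).
  by rewrite sumr_const card_ord -mulr_natl mulrA ler_wpM2r // /L lerDl.
have lipB a b : support_function X a - support_function X b <= L * `|a - b|.
  rewrite lerBlDr -{1}(subrK b a); apply: le_trans (supportD_le _ _ _ cX X0) _.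
  by rewrite lerD2r.
move=> a; apply/(@cvgrPdist_le R R 'rV[R]_n (nbhs (a : 'rV[R]_n))) => e e0.
have eL : 0 < e / L by rewrite divr_gt0.
near=> b.
have ab : L * `|a - b| <= e.
  by rewrite mulrC -ler_pdivlMr //; near: b; apply: cvgr_dist_le.
rewrite ler_norml; apply/andP; split.
  by rewrite lerNl opprB; apply: le_trans (lipB _ _) _; rewrite distrC.
exact: le_trans (lipB _ _) ab.
Unshelve. all: by end_near. Qed.

Lemma support0 X : X !=set0 -> support_function X 0 = 0.
Proof.
move=> [x Xx]; rewrite /support_function (_ : [set _ | _ in _] = [set 0]) ?sup1 //.
apply/seteqP; split=> [_ [y _ <-]|_ ->] /=; first exact: dot0l.
by exists x => //; exact: dot0l.
Qed.

(** Pairs (B, t) that encode the affine maps x |-> xB + t sending X into Y. *)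
Definition affine_fits X Y : set ('M[R]_n * 'rV[R]_n) :=
  [set f | forall x, X x -> Y (x *m f.1 + f.2)].

(** Closed, because each condition xB + t in Y is closed.  Bounded, because X
    contains c and c + e v for all unit v, so that e vB is a difference of two
    points of the bounded set Y; this bounds B, and then t. *)
Lemma affine_fits_compact X Y : convex_body X -> compact Y -> compact (affine_fits X Y).
Proof.
move=> bX cY; have [m m0 Ym] := compact_norm_le _ cY.
have [c [e e0 Xe]] := body_ball _ bX.
have Xc : X c by rewrite -[c]addr0 -[0](scaler0 _ e); apply: Xe; rewrite normr0.
pose N := 2 * m / e.
pose N' := m + \sum_k `|c 0 k| * N.
apply: (@subclosed_compact _ _
  ([set A : 'M[R]_n | `|A| <= N] `*` [set t : 'rV[R]_n | `|t| <= N'])).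
- rewrite (_ : affine_fits X Y =
    \bigcap_(x in X) (fun f : 'M[R]_n * 'rV[R]_n => x *m f.1 + f.2) @^-1` Y) //.
  apply: closed_bigI => x _; apply: preimage_closed.
    have c1 : continuous (fun f : 'M[R]_n * 'rV[R]_n => x *m f.1).
      apply: (mulmx_continuous (cst x) fst); first exact: cst_continuous.
      by move=> g; exact: cvg_fst.
    have c2 : continuous (fun f : 'M[R]_n * 'rV[R]_n => f.2).
      by move=> g; exact: cvg_snd.
    by move=> f _; exact: (continuousD (c1 f) (c2 f)).
  exact: (compact_closed (@norm_hausdorff _ _) cY).
- by apply: compact_setX; exact: mx_ball_compact.
- move=> [A t] fA /=.
  have nA : `|A| <= N.
    have N0 : 0 <= N by rewrite divr_ge0 ?mulr_ge0 // ltW.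
    apply: mx_norm_le => // i j.
    have d1 : `|delta_mx 0 i : 'rV[R]_n| <= 1.
      apply: mx_norm_le => // k l; rewrite mxE.
      by case: (_ && _); rewrite ?normr1 ?normr0.
    have := Ym _ (fA _ (Xe _ d1)); have := Ym _ (fA _ Xc) => /= Y1 Y2.
    rewrite /N ler_pdivlMr // mulrC -(gtr0_norm e0) -normrM.
    have -> : e * A i j = ((c + e *: delta_mx 0 i) *m A + t - (c *m A + t)) 0 j.
      rewrite mulmxDl opprD addrACA subrr addr0 addrAC subrr add0r.
      by rewrite -scalemxAl -rowE !mxE.
    apply: le_trans (coord_le_norm _ _ _) _; apply: le_trans (ler_normB _ _) _.
    lra.
  split=> //=.
  have -> : t = (c *m A + t) - c *m A by rewrite addrAC subrr add0r.
  apply: le_trans (ler_normB _ _) _; rewrite lerD //; first exact: Ym (fA _ Xc).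
  apply: mx_norm_le => [|i j].
    by apply: sumr_ge0 => k _; rewrite mulr_ge0 // (le_trans _ nA).
  rewrite mxE ord1; apply: le_trans (ler_norm_sum _ _ _) _.
  apply: ler_sum => k _; rewrite normrM ler_wpM2l //.
  exact: le_trans (coord_le_norm _ _ _) nA.
Qed.

End ConvexBodies.

(** * Circumradius, inradius, width and diameter *)

Lemma inf_is_min {R : realType} (S : set R) m : is_min S m -> inf S = m.
Proof.
move=> [Sm lbm]; apply/eqP; rewrite eq_le; apply/andP; split.
  by apply: ge_inf => //; exists m.
by apply: lb_le_inf => //; exists m.
Qed.

Lemma sup_is_max {R : realType} (S : set R) m : is_max S m -> sup S = m.
Proof.
move=> [Sm ubm]; apply/eqP; rewrite eq_le; apply/andP; split.
  by apply: ge_sup => //; exists m.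
by apply: ub_le_sup => //; exists m.
Qed.

Section Radii.
Context {R : realType} {n : nat}.
Implicit Types (X Y C K : set 'rV[R]_n) (a b x p t v : 'rV[R]_n) (A B : 'M[R]_n).
Implicit Types (rho omega : R) (f g : 'rV[R]_n -> R).

(** For support functions f = h_X, g = h_Y and rho >= 0 this is X ⊂_t rho Y, see
    [subset_t_dilateP].  Stating it for arbitrary functions allows substitutions in
    the direction. *)
Definition fits f g rho := exists t, forall a, f a + dot a t <= rho * g a.

Lemma fits_breadth f g rho a : fits f g rho ->
  f a + f (- a) <= rho * (g a + g (- a)).
Proof.
move=> [t ft]; have := ft a; have := ft (- a); rewrite dotNl; lra.
Qed.

Lemma fits_mulmx f g rho A : fits f g rho ->
  fits (fun a => f (a *m A)) (fun a => g (a *m A)) rho.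
Proof.
by move=> [t ft]; exists (t *m A^T) => a; rewrite dot_mulmx trmxK.
Qed.

Lemma subset_t_dilateP X Y rho : convex_body X -> convex_body Y -> 0 <= rho ->
  subset_t X (dilate rho Y) <-> fits (support_function X) (support_function Y) rho.
Proof.
move=> bX bY r0; have [y Yy] := body_nonempty _ bY.
rewrite subset_tP; [|exact: body_compact|exact: body_nonempty| | |]; last first.
- by exists (rho *: y); exists y.
- by rewrite dilateE; apply: linear_image_convex; exact: body_convex.
- by rewrite dilateE; apply: linear_image_compact; exact: body_compact.
have e a : support_function (dilate rho Y) a = rho * support_function Y a.
  by rewrite support_dilate supportZ //; [exact: body_compact|exists y].
by split=> -[t ft]; exists t => a; have := ft a; rewrite e.
Qed.

Lemma subset_t_dilateV X Y rho : 0 < rho ->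
  subset_t (dilate rho X) Y <-> subset_t X (dilate rho^-1 Y).
Proof.
move=> r0; have rn0 : rho != 0 by rewrite gt_eqF.
split=> -[t tXY].
  exists (rho^-1 *: t) => _ [x Xx <-].
  exists (rho *: x + t); first by apply: tXY; exists (rho *: x) => //; exists x.
  by rewrite scalerDr scalerA mulVf // scale1r.
exists (rho *: t) => _ [_ [x Xx <-] <-].
have [|y Yy yE] := tXY (x + t); first by exists x.
by rewrite -scalerDr -yE scalerA divff // scale1r.
Qed.

Lemma breadth_linear_image A X a :
  breadth (linear_image A X) a = breadth X (a *m A^T).
Proof. by rewrite /breadth !support_linear_image mulNmx. Qed.

Lemma breadth0 X : X !=set0 -> breadth X 0 = 0.
Proof. by move=> X0; rewrite /breadth oppr0 support0 // addr0. Qed.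

Section PositiveDimension.
Hypothesis n_gt0 : (0 < n)%N.

Lemma breadth_delta_gt0 C : convex_body C -> 0 < breadth C (delta_mx 0 (Ordinal n_gt0)).
Proof.
move=> bC; apply: breadth_gt0 => //; apply/rV0Pn; exists (Ordinal n_gt0).
by rewrite mxE !eqxx oner_eq0.
Qed.

(** A body of positive dimension does not fit into a point; compare breadths. *)
Lemma fits_gt0 X Y rho : convex_body X -> convex_body Y ->
  fits (support_function X) (support_function Y) rho -> 0 < rho.
Proof.
move=> bX bY ft; have := fits_breadth _ _ _ (delta_mx 0 (Ordinal n_gt0)) ft.
rewrite -!/(breadth _ _) => /(lt_le_trans (breadth_delta_gt0 _ bX)).
by rewrite pmulr_lgt0 // breadth_delta_gt0.
Qed.

(** The infimum is attained: X ⊂_t rho Y means that the homothety of ratio 1/rho,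
    followed by some translation, maps X into Y.  These homotheties form a closed
    subset of a compact set of affine maps, so there is one of largest ratio. *)
Lemma circumradius_is_min X Y : convex_body X -> convex_body Y ->
  is_min [set rho | 0 <= rho /\ subset_t X (dilate rho Y)] (circumradius X Y).
Proof.
move=> bX bY; set F := [set rho | _].
suff [r0 [Fr0 r0min]] : exists r, is_min F r by rewrite /circumradius (inf_is_min _ r0).
have F_gt0 r : F r -> 0 < r.
  by move=> [r0 /(subset_t_dilateP _ _ _ bX bY r0)]; exact: fits_gt0.
(* Homotheties are singled out as the scalar matrices; the ratio is read off a
   diagonal entry. *)
pose i0 := Ordinal n_gt0.
pose S := affine_fits X Y `&`
  [set f : 'M[R]_n * 'rV[R]_n | f.1 = (f.1 i0 i0)%:M].
have SF r : F r -> exists t, S ((r^-1)%:M, t).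
  move=> Fr; have r_gt0 := F_gt0 _ Fr; case: Fr => _.
  rewrite -{1}(invrK r) -subset_t_dilateV ?invr_gt0 // => -[t tXY].
  exists t; split=> [x Xx|] /=; last by rewrite mxE eqxx mulr1n.
  by rewrite mul_mx_scalar; apply: tXY; exists (r^-1 *: x) => //; exists x.
have cS : compact S.
  apply: compact_closedI; first by apply: affine_fits_compact => //; exact: body_compact.
  pose d (f : 'M[R]_n * 'rV[R]_n) := f.1 - (f.1 i0 i0)%:M.
  have -> : [set f : 'M[R]_n * 'rV[R]_n | f.1 = (f.1 i0 i0)%:M] = d @^-1` [set 0].
    apply/seteqP; split=> f; rewrite /d /= => /eqP.
      by rewrite -subr_eq0 => /eqP.
    by rewrite subr_eq0 => /eqP.
  apply: preimage_closed; last first.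
    by apply: compact_closed; [exact: norm_hausdorff|exact: compact_set1].
  move=> f0 _; apply: mx_continuous => i j.
  have c1 k l : continuous (fun f : 'M[R]_n * 'rV[R]_n => f.1 k l).
    by apply: coord_comp_continuous => f; exact: cvg_fst.
  have -> : (fun q => d q i j) = (fun q => q.1 i j - q.1 i0 i0 * (i == j)%:R).
    by apply/funext => q; rewrite !mxE mulr_natr.
  have c2 : continuous (fun q : 'M[R]_n * 'rV[R]_n => q.1 i0 i0 * (i == j)%:R).
    by move=> q; apply: cvgM; [exact: c1|exact: cvg_cst].
  by move=> q; exact: (continuousB (c1 i j q) (c2 q)).
have [r1 r1_gt0 Xr1] := compact_subset_t _ _ (body_compact _ bX) bY.
have Fr1 : F r1 by split=> //; exact: ltW.
have [t1 St1] := SF _ Fr1.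
have fc : continuous (fun f : 'M[R]_n * 'rV[R]_n => f.1 i0 i0).
  by apply: coord_comp_continuous => f; exact: cvg_fst.
have [[A t] /set_mem [/= EA Ascal] Amax] :=
  compact_EVT_max (ex_intro _ _ St1) cS (continuous_subspaceT fc).
have mu_max r : F r -> r^-1 <= A i0 i0.
  move=> /SF[u /mem_set /Amax] /=.
  by rewrite mxE eqxx mulr1n.
have mu_gt0 : 0 < A i0 i0.
  by apply: lt_le_trans (mu_max _ Fr1); rewrite invr_gt0.
exists (A i0 i0)^-1; split; last first.
  move=> r Fr; rewrite -[leRHS]invrK lef_pV2 ?mu_max // posrE ?invr_gt0 //.
  exact: F_gt0.
split; first by rewrite invr_ge0 ltW.
rewrite -subset_t_dilateV //; exists t => _ [_ [x Xx <-] <-].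
by rewrite -mul_mx_scalar -Ascal; exact: EA.
Qed.

Lemma circumradius_fits X Y : convex_body X -> convex_body Y ->
  fits (support_function X) (support_function Y) (circumradius X Y).
Proof.
move=> bX bY.
by have [[r0 /(subset_t_dilateP _ _ _ bX bY r0)]] := circumradius_is_min _ _ bX bY.
Qed.

Lemma circumradius_gt0 X Y : convex_body X -> convex_body Y -> 0 < circumradius X Y.
Proof.
move=> bX bY; exact: fits_gt0 bX bY (circumradius_fits _ _ bX bY).
Qed.

Lemma circumradius_le X Y rho : convex_body X -> convex_body Y ->
  fits (support_function X) (support_function Y) rho -> circumradius X Y <= rho.
Proof.
move=> bX bY ft; have r0 := ltW (fits_gt0 _ _ _ bX bY ft).
have [_] := circumradius_is_min _ _ bX bY; apply; split=> //.
exact/subset_t_dilateP.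
Qed.

(** rho X ⊂_t Y is the same as X ⊂_t (1/rho) Y. *)
Lemma inradius_circumradius X Y : convex_body X -> convex_body Y ->
  inradius Y X = (circumradius X Y)^-1.
Proof.
move=> bX bY; have r0 := circumradius_gt0 _ _ bX bY.
have [[_ Fr] rmin] := circumradius_is_min _ _ bX bY.
apply: sup_is_max; split.
  split; first by rewrite invr_ge0 ltW.
  by rewrite subset_t_dilateV ?invr_gt0 // invrK.
move=> r []; rewrite [0 <= r]le_eqVlt => /predU1P[<- _|r_gt0].
  by rewrite invr_ge0 ltW.
rewrite subset_t_dilateV // => Xr; rewrite -[leLHS]invrK lef_pV2 ?posrE ?invr_gt0 //.
by apply: rmin; split => //; rewrite invr_ge0 ltW.
Qed.

Lemma circumradius_linear_image X Y A : A \in unitmx ->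
  convex_body X -> convex_body Y ->
  circumradius X (linear_image A Y) = circumradius (linear_image (invmx A) X) Y.
Proof.
move=> uA bX bY.
have bYA := convex_body_linear_image _ _ uA bY.
have bXA : convex_body (linear_image (invmx A) X).
  by apply: convex_body_linear_image => //; rewrite unitmx_inv.
apply/eqP; rewrite eq_le; apply/andP; split; apply: circumradius_le => //.
  have := fits_mulmx _ _ _ A^T (circumradius_fits _ _ bXA bY).
  move=> [t ft]; exists t => a; have := ft a.
  by rewrite !support_linear_image -mulmxA -trmx_mul mulVmx // trmx1 mulmx1.
have := fits_mulmx _ _ _ (invmx A)^T (circumradius_fits _ _ bX bYA).
move=> [t ft]; exists t => a; have := ft a.
by rewrite !support_linear_image -mulmxA -trmx_mul mulmxV // trmx1 mulmx1.
Qed.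

(** Universal property of the width; at a = 0 both breadths vanish. *)
Lemma width_geP C K omega : convex_body C -> convex_body K ->
  2 * omega <= width C K <-> forall a, omega * breadth K a <= breadth C a.
Proof.
move=> bC bK; split=> [wC a|ob].
  have [->|a0] := eqVneq a 0.
    by rewrite !breadth0 ?mulr0 //; exact: body_nonempty.
  rewrite -ler_pdivlMr ?breadth_gt0 // -(ler_pM2l (ltr0n R 2)).
  apply: le_trans wC _; apply: ge_inf; last by exists a.
  exists 0 => _ [b b0 <-].
  by rewrite mulr_ge0 // divr_ge0 // ltW // breadth_gt0.
apply: lb_le_inf.
  pose e : 'rV[R]_n := delta_mx 0 (Ordinal n_gt0).
  exists (2 * (breadth C e / breadth K e)), e => //=.
  by apply/rV0Pn; exists (Ordinal n_gt0); rewrite mxE !eqxx oner_eq0.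
by move=> _ [a a0 <-]; rewrite ler_pM2l // ler_pdivlMr ?breadth_gt0.
Qed.

Lemma width_gt0 C K : convex_body C -> convex_body K -> 0 < width C K.
Proof.
move=> bC bK; have ft := circumradius_fits _ _ bK bC.
have r0 := circumradius_gt0 _ _ bK bC.
apply: (@lt_le_trans _ _ (2 * (circumradius K C)^-1)).
  by rewrite mulr_gt0 // invr_gt0.
apply/width_geP => // a; rewrite mulrC ler_pdivrMr // mulrC.
exact: fits_breadth.
Qed.

Lemma width_linear_image C K A : A \in unitmx -> convex_body C -> convex_body K ->
  width C (linear_image A K) = width (linear_image (invmx A) C) K.
Proof.
move=> uA bC bK.
have bKA := convex_body_linear_image _ _ uA bK.
have bCA : convex_body (linear_image (invmx A) C).
  by apply: convex_body_linear_image => //; rewrite unitmx_inv.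
have half (w : R) : w = 2 * (w / 2) by rewrite mulrC divfK.
apply/eqP; rewrite eq_le; apply/andP; split; rewrite [leLHS]half; apply/width_geP => // a.
  have := lexx (width C (linear_image A K)).
  rewrite [leLHS]half => /(width_geP _ _ _ bC bKA)/(_ (a *m (invmx A)^T)).
  by rewrite !breadth_linear_image -mulmxA -trmx_mul mulmxV // trmx1 mulmx1.
have := lexx (width (linear_image (invmx A) C) K).
rewrite [leLHS]half => /(width_geP _ _ _ bCA bK)/(_ (a *m A^T)).
by rewrite !breadth_linear_image -mulmxA -trmx_mul mulVmx // trmx1 mulmx1.
Qed.

(** Inverting each quotient exchanges the supremum and the infimum; the factor 4
    comes from the factor 2 in both definitions. *)
Lemma diameter_width C K : convex_body C -> convex_body K ->
  diameter K C = 4 / width C K.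
Proof.
move=> bC bK; have w0 := width_gt0 _ _ bC bK.
pose e : 'rV[R]_n := delta_mx 0 (Ordinal n_gt0).
have e0 : e != 0.
  by apply/rV0Pn; exists (Ordinal n_gt0); rewrite mxE !eqxx oner_eq0.
rewrite /diameter; set S := [set _ | _ in _].
have Sub : ubound S (4 / width C K).
  move=> _ [a a0 <-]; rewrite ler_pdivlMr //.
  have bCa := breadth_gt0 _ _ bC a0; have bKa := breadth_gt0 _ _ bK a0.
  have half (w : R) : w = 2 * (w / 2) by rewrite mulrC divfK.
  have := lexx (width C K); rewrite [leLHS]half => /(width_geP _ _ _ bC bK)/(_ a).
  move=> wa; rewrite -ler_pdivlMr // in wa.
  have -> : 2 * (breadth K a / breadth C a) * width C K =
            4 * (width C K / 2 / (breadth C a / breadth K a)).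
    by field; rewrite !gt_eqF.
  by rewrite -[leRHS]mulr1 ler_pM2l // ler_pdivrMr ?mul1r // divr_gt0.
have Se : S (2 * (breadth K e / breadth C e)) by exists e.
apply/eqP; rewrite eq_le; apply/andP; split.
  by apply: ge_sup => //; exists (2 * (breadth K e / breadth C e)).
have ubS := ub_le_sup (ex_intro _ _ Sub : has_ubound S).
have u0 : 0 < sup S.
  apply: lt_le_trans (ubS _ Se).
  by rewrite mulr_gt0 // divr_gt0 // breadth_gt0.
rewrite ler_pdivrMr // mulrC -ler_pdivrMr //.
have -> : 4 / sup S = 2 * (2 / sup S) by rewrite mulrA; congr (_ / _); rewrite -natrM.
apply/width_geP => // a; have [->|a0] := eqVneq a 0.
  by rewrite !breadth0 ?mulr0 //; exact: body_nonempty.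
rewrite mulrAC ler_pdivrMr // -ler_pdivrMl ?breadth_gt0 //.
rewrite mulrC -mulrA; apply: ubS; by exists a.
Qed.

End PositiveDimension.

End Radii.

(** * The common extremal problem *)

Section Optimum.
Context {R : realType} {n : nat}.
Hypothesis n_gt0 : (0 < n)%N.
Implicit Types (X Y C K : set 'rV[R]_n) (a b x p t v : 'rV[R]_n) (A B : 'M[R]_n).
Implicit Types (rho omega : R).

(** Up to scaling B, a width quotient of at least omega (for omega > 0), see
    [width_ratio_admissible] and [admissible_width_ratio].  The two conditions on
    (B, t) are closed, and for omega > 0 they force B to be invertible
    ([admissible_unit]). *)
Definition admissible C K omega := exists B t,
  (forall a, support_function C (a *m B^T) + dot a t <= support_function K a) /\
  (forall a, omega * breadth K a <= breadth C (a *m B^T)).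

Lemma admissible_le1 C K omega : convex_body K ->
  admissible C K omega -> omega <= 1.
Proof.
move=> bK [B [t [CK ob]]].
have b0 := breadth_delta_gt0 n_gt0 _ bK.
rewrite -(ler_pM2r b0) mul1r; apply: le_trans (ob _) _.
set e := delta_mx 0 _; have := CK e; have := CK (- e).
rewrite /breadth mulNmx dotNl; lra.
Qed.

Lemma affine_fits_support C K B t : convex_body C -> convex_body K ->
  affine_fits C K (B, t) <->
  forall a, support_function C (a *m B^T) + dot a t <= support_function K a.
Proof.
move=> bC bK; split=> [CK a|CK x Cx /=].
  rewrite -lerBrDr; apply: support_le => [|x Cx]; first exact: body_nonempty.
  rewrite lerBrDr -dot_mulmx -dotDr; apply: dot_le_support; first exact: body_compact.
  exact: CK.
apply: mem_of_dot_le_support => [|||a].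
- exact: body_compact.
- exact: body_convex.
- exact: body_nonempty.
- rewrite dotDr dot_mulmx; apply: le_trans (CK a).
  by rewrite lerD2r dot_le_support //; exact: body_compact.
Qed.

(** A small homothetic copy of C inside K. *)
Lemma admissible_pos C K : convex_body C -> convex_body K ->
  exists2 omega, 0 < omega & admissible C K omega.
Proof.
move=> bC bK.
have rC := circumradius_gt0 n_gt0 _ _ bC bK; have rK := circumradius_gt0 n_gt0 _ _ bK bC.
set r := circumradius C K in rC; set s := circumradius K C in rK.
have CK : fits (support_function C) (support_function K) r by exact: circumradius_fits.
have KC : fits (support_function K) (support_function C) s by exact: circumradius_fits.
have sZ a : support_function C (r^-1 *: a) = r^-1 * support_function C a.
  by rewrite supportZ ?invr_ge0 ?ltW //; [exact: body_compact|exact: body_nonempty].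
have aZ a : a *m (r^-1%:M)^T = r^-1 *: a by rewrite tr_scalar_mx mul_mx_scalar.
exists (r^-1 * s^-1); first by rewrite mulr_gt0 ?invr_gt0.
have [t ft] := CK; exists r^-1%:M, (r^-1 *: t); split=> a.
  rewrite aZ sZ dotZr -mulrDr mulrC ler_pdivrMr // mulrC.
  exact: ft.
rewrite aZ /breadth -scalerN !sZ -mulrDr -mulrA ler_pM2l ?invr_gt0 //.
by rewrite mulrC ler_pdivrMr // mulrC; exact: fits_breadth.
Qed.

(** The triples (B, t, omega) with omega in [0, 1] form a compact set, and the
    coordinate omega is continuous on it. *)
Lemma admissible_max C K : convex_body C -> convex_body K ->
  exists2 M, 0 < M & is_max (admissible C K) M.
Proof.
move=> bC bK; have [w w0 [B0 [t0 [CK0 ob0]]]] := admissible_pos _ _ bC bK.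
pose T := (('M[R]_n * 'rV[R]_n) * R)%type.
pose S : set T := (affine_fits C K `*` `[0, 1]) `&`
  \bigcap_(a in [set: 'rV[R]_n])
     [set q : T | q.2 * breadth K a <= breadth C (a *m q.1.1^T)].
have SP om : 0 < om -> admissible C K om -> exists B t, S ((B, t), om).
  move=> om0 aom; have om1 := admissible_le1 _ _ _ bK aom.
  have [B [t [CK ob]]] := aom; exists B, t; split; last by move=> a _; exact: ob.
  by split; [exact/affine_fits_support | rewrite /= in_itv /= ltW].
have cS : compact S.
  apply: compact_closedI.
    apply: compact_setX; last exact: segment_compact.
    by apply: affine_fits_compact => //; exact: body_compact.
  apply: closed_bigI => a _.
  have ca : continuous (fun q : T => a *m q.1.1^T).
    apply: (mulmx_continuous (cst a) (fun q : T => q.1.1^T)); first exact: cst_continuous.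
    apply: trmx_continuous => q.
    apply: (@continuous_comp _ _ _ (@fst ('M[R]_n * 'rV[R]_n) R) fst); exact: cvg_fst.
  have cNa : continuous (fun q : T => - (a *m q.1.1^T)).
    by move=> q; exact: (continuousN (ca q)).
  have ch := support_continuous _ (body_compact _ bC) (body_nonempty _ bC).
  have c1 : continuous (fun q : T => support_function C (a *m q.1.1^T)).
    by move=> q; exact: (@continuous_comp _ _ _ _ (support_function C) q (ca q) (ch _)).
  have c2 : continuous (fun q : T => support_function C (- (a *m q.1.1^T))).
    by move=> q; exact: (@continuous_comp _ _ _ _ (support_function C) q (cNa q) (ch _)).
  have c3 : continuous (fun q : T => q.2 * breadth K a).
    by move=> q; apply: cvgM; [exact: cvg_snd|exact: cvg_cst].
  pose d (q : T) := breadth C (a *m q.1.1^T) - q.2 * breadth K a.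
  have -> : [set q : T | q.2 * breadth K a <= breadth C (a *m q.1.1^T)] =
            d @^-1` [set x | 0 <= x].
    by apply/seteqP; split=> q; rewrite /= /d subr_ge0.
  apply: preimage_closed; last exact: closed_ge.
  by move=> q _; exact: (continuousB (continuousD (c1 q) (c2 q)) (c3 q)).
have [B1 [t1 S1]] := SP _ w0 (ex_intro _ B0 (ex_intro _ t0 (conj CK0 ob0))).
have sc : continuous (@snd ('M[R]_n * 'rV[R]_n) R) by move=> q; exact: cvg_snd.
have [[[B t] M] /set_mem [[/= E _] ob] Mmax] :=
  compact_EVT_max (ex_intro _ _ S1) cS (continuous_subspaceT sc).
have M0 : 0 < M by apply: lt_le_trans w0 _; exact: (Mmax _ (mem_set S1)).
exists M => //; split.
  exists B, t; split; first exact/affine_fits_support.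
  by move=> a; exact: (ob a).
move=> om aom; have [om0|om0] := ltP 0 om; last exact: le_trans om0 (ltW M0).
have [B2 [t2 S2]] := SP _ om0 aom; exact: (Mmax _ (mem_set S2)).
Qed.

(** A singular B would flatten C, giving breadth 0 in some direction. *)
Lemma admissible_unit C K omega B : convex_body C -> convex_body K -> 0 < omega ->
  (forall a, omega * breadth K a <= breadth C (a *m B^T)) -> B \in unitmx.
Proof.
move=> bC bK om0 ob; rewrite -unitmx_tr unitmxE unitfE; apply/det0P => -[a a0 aB].
have := ob a; rewrite aB breadth0; last exact: body_nonempty.
by rewrite leNgt mulr_gt0 // breadth_gt0.
Qed.

Definition width_ratio C K B :=
  width (linear_image B C) K / (2 * circumradius (linear_image B C) K).

Lemma width_ratio_gt0 C K B : convex_body C -> convex_body K -> B \in unitmx ->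
  0 < width_ratio C K B.
Proof.
move=> bC bK uB; have bCB := convex_body_linear_image _ _ uB bC.
by rewrite divr_gt0 ?mulr_gt0 ?width_gt0 ?circumradius_gt0.
Qed.

(** Divide B by the circumradius of its image, so that the image fits into K. *)
Lemma width_ratio_admissible C K B : convex_body C -> convex_body K -> B \in unitmx ->
  admissible C K (width_ratio C K B).
Proof.
move=> bC bK uB; have bCB := convex_body_linear_image _ _ uB bC.
rewrite /width_ratio; set r := circumradius _ _; set w := width _ _.
have r0 : 0 < r by exact: circumradius_gt0.
have [t ft] : fits (support_function (linear_image B C)) (support_function K) r.
  exact: circumradius_fits.
have sZ a : support_function C (a *m (r^-1 *: B)^T) =
            r^-1 * support_function (linear_image B C) a.
  rewrite support_linear_image linearZ /= -scalemxAr supportZ ?invr_ge0 ?ltW //.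
    exact: body_compact.
  exact: body_nonempty.
exists (r^-1 *: B), (r^-1 *: t); split=> a.
  rewrite sZ dotZr -mulrDr mulrC ler_pdivrMr // mulrC.
  exact: ft.
rewrite {2}/breadth -mulNmx !sZ -mulrDr invfM mulrA [_ * r^-1]mulrC -mulrA.
rewrite ler_pM2l ?invr_gt0 //; move: a; apply/(width_geP n_gt0) => //.
by rewrite mulrC divfK.
Qed.

(** If the image of C fits into K then its circumradius is at most 1, so the
    quotient is at least half the width. *)
Lemma admissible_width_ratio C K omega : convex_body C -> convex_body K ->
  0 < omega -> admissible C K omega ->
  exists2 B, B \in unitmx & omega <= width_ratio C K B.
Proof.
move=> bC bK om0 [B [t [CK ob]]].
have uB : B \in unitmx by exact: admissible_unit ob.
exists B => //; have bCB := convex_body_linear_image _ _ uB bC.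
have r0 := circumradius_gt0 n_gt0 _ _ bCB bK.
rewrite ler_pdivlMr ?mulr_gt0 //; apply: (@le_trans _ _ (2 * omega)).
  rewrite mulrCA ler_pM2l // -[leRHS]mulr1 ler_pM2l //.
  apply: circumradius_le => //; exists t => a.
  by rewrite support_linear_image mul1r.
by apply/(width_geP n_gt0) => // a; rewrite breadth_linear_image.
Qed.

Lemma width_ratios_max C K M : convex_body C -> convex_body K -> 0 < M ->
  is_max (admissible C K) M -> is_max (width_ratios K C) M.
Proof.
move=> bC bK M0 [aM Mmax].
have [B uB MB] := admissible_width_ratio _ _ _ bC bK M0 aM.
split=> [|_ [A uA <-]]; last by apply: Mmax; exact: width_ratio_admissible.
exists B => //; apply/eqP; rewrite eq_le MB andbT.
by apply: Mmax; exact: width_ratio_admissible.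
Qed.

(** Transport the pair (KA, C) by A^-1 to the pair (K, CA^-1). *)
Lemma diameter_ratioE C K A : convex_body C -> convex_body K -> A \in unitmx ->
  diameter (linear_image A K) C / (2 * inradius (linear_image A K) C) =
  (width_ratio C K (invmx A))^-1.
Proof.
move=> bC bK uA; have bKA := convex_body_linear_image _ _ uA bK.
have bCA : convex_body (linear_image (invmx A) C).
  by apply: convex_body_linear_image => //; rewrite unitmx_inv.
rewrite diameter_width // inradius_circumradius // width_linear_image //.
rewrite circumradius_linear_image // /width_ratio.
have r0 := circumradius_gt0 n_gt0 _ _ bCA bK; have w0 := width_gt0 n_gt0 _ _ bCA bK.
by field; rewrite !gt_eqF.
Qed.

Lemma diameter_ratios_min C K M : convex_body C -> convex_body K -> 0 < M ->
  is_max (admissible C K) M -> is_min (diameter_ratios K C) M^-1.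
Proof.
move=> bC bK M0 aM; have [[B uB MB] Mmax] := width_ratios_max _ _ _ bC bK M0 aM.
split=> [|_ [A uA <-]].
  exists (invmx B); first by rewrite /= unitmx_inv.
  by rewrite diameter_ratioE ?unitmx_inv // invmxK -MB.
rewrite diameter_ratioE // lef_pV2 ?posrE //.
  by apply: Mmax; exists (invmx A) => //=; rewrite unitmx_inv.
by apply: width_ratio_gt0 => //; rewrite unitmx_inv.
Qed.

End Optimum.

(** * Asymmetry and the two inclusion arguments *)

Section Fits.
Context {R : realType} {n : nat}.
Implicit Types (X Y C K : set 'rV[R]_n) (a : 'rV[R]_n) (f g k : 'rV[R]_n -> R).

Lemma fits_trans f g k (r s : R) : 0 <= r -> fits f g r -> fits g k s -> fits f k (r * s).
Proof.
move=> r0 [t ft] [u gu]; exists (t + r *: u) => a.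
rewrite dotDr dotZr addrA -mulrA; have := ler_wpM2l r0 (gu a).
by rewrite mulrDr; have := ft a; lra.
Qed.

Lemma fits_opp f g (r : R) : fits f g r -> fits (fun a => f (- a)) (fun a => g (- a)) r.
Proof. by move=> [t ft]; exists (- t) => a; rewrite dotNr -dotNl. Qed.

(** The case rho = 1 of [subset_t_dilateP] without a dilation in the statement. *)
Lemma subset_t_fits X Y : convex_body X -> convex_body Y ->
  subset_t X Y <-> fits (support_function X) (support_function Y) 1.
Proof.
move=> bX bY.
rewrite subset_tP;
  [|exact: body_compact|exact: body_nonempty|exact: body_compact|exact: body_convex
   |exact: body_nonempty].
by split=> -[t ft]; exists t => a; have := ft a; rewrite mul1r.
Qed.

Lemma breadthZ X (r : R) a : compact X -> X !=set0 ->
  breadth X (r *: a) = `|r| * breadth X a.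
Proof.
move=> cX X0; rewrite /breadth -scalerN; case: (ger0P r) => r0.
  by rewrite !supportZ // mulrDr.
have -> : r *: a = (- r) *: (- a) by rewrite scaleNr scalerN opprK.
have -> : r *: (- a) = (- r) *: a by rewrite scaleNr scalerN.
by rewrite !supportZ ?oppr_ge0 ?ltW // -mulrDr [X in _ * X]addrC.
Qed.

(** Symmetry about c makes the difference of h_X and the linear form of c an even
    function. *)
Lemma centrally_symmetric_support X : convex_body X -> centrally_symmetric X ->
  exists c, forall a, support_function X a = support_function X (- a) + 2 * dot a c.
Proof.
move=> bX [c Xc]; exists c.
have cX := body_compact _ bX; have X0 := body_nonempty _ bX.
have le a : support_function X a <= support_function X (- a) + 2 * dot a c.
  apply: support_le => // x Xx.
  have [y Xy /eqP] : [set c - x | x in X] (x - c) by rewrite -Xc; exists x.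
  rewrite eq_sym subr_eq => /eqP ->.
  have := dot_le_support _ (- a) _ cX Xy.
  rewrite !(dotDr, dotNr, dotNl); lra.
move=> a; apply/eqP; rewrite eq_le le /=.
by have := le (- a); rewrite opprK dotNl; lra.
Qed.

End Fits.

Section Bounds.
Context {R : realType} {n : nat}.
Hypothesis n_gt0 : (0 < n)%N.
Implicit Types (X Y C K : set 'rV[R]_n) (a b x p t v : 'rV[R]_n) (A B : 'M[R]_n).
Implicit Types (rho omega : R).

(** The asymmetry is by definition the circumradius of -K in K, so it is attained. *)
Lemma asymmetry_fits K : convex_body K ->
  fits (fun a => support_function K (- a)) (support_function K) (asymmetry K).
Proof.
move=> bK; have bNK : convex_body (dilate (-1) K).
  by apply: convex_body_dilate => //; rewrite oppr_eq0 oner_eq0.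
have [t ft] := circumradius_fits n_gt0 _ _ bNK bK; exists t => a.
by have := ft a; rewrite support_dilate scaleN1r.
Qed.

Lemma asymmetry_le K rho : convex_body K ->
  fits (fun a => support_function K (- a)) (support_function K) rho -> asymmetry K <= rho.
Proof.
move=> bK [t ft]; have bNK : convex_body (dilate (-1) K).
  by apply: convex_body_dilate => //; rewrite oppr_eq0 oner_eq0.
apply: (circumradius_le n_gt0 (dilate (-1) K) K) => //.
by exists t => a; rewrite support_dilate scaleN1r.
Qed.

(** K and -K have the same breadth. *)
Lemma asymmetry_ge1 K : convex_body K -> 1 <= asymmetry K.
Proof.
move=> bK; have b0 := breadth_delta_gt0 n_gt0 _ bK.
rewrite -(ler_pM2r b0) mul1r; set e := delta_mx 0 _.
by have := fits_breadth _ _ _ e (asymmetry_fits _ bK); rewrite opprK [X in X <= _]addrC.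
Qed.

(** From omega (K - K) ⊂ C - C ⊂_t (s(C)+1) C ⊂_t (s(C)+1) K, where C stands for its
    affine image, cancel one copy of K.  With support functions cancelling is a
    subtraction. *)
Lemma admissible_bound_circumscribed C K omega :
  convex_body C -> convex_body K -> 0 < omega -> admissible C K omega ->
  omega * (asymmetry K + 1) <= asymmetry C + 1.
Proof.
move=> bC bK om0 aom; have om1 := admissible_le1 n_gt0 _ _ _ bK aom.
have [B [t [CK ob]]] := aom.
have s1 := asymmetry_ge1 _ bC; set s := asymmetry C in s1 *.
have [u Cu] := fits_mulmx _ _ _ B^T (asymmetry_fits _ bC).
suff : asymmetry K <= (s + 1) / omega - 1.
  by rewrite lerBrDr ler_pdivlMr // mulrC.
apply: asymmetry_le => //; exists (omega^-1 *: ((s + 1) *: t + u)) => a.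
rewrite dotZr dotDr dotZr -(ler_pM2l om0) mulrDr mulrA mulfV ?gt_eqF // mul1r.
rewrite mulrA mulrBr mulr1 mulrC [omega * _]mulrC divfK ?gt_eqF //.
have := Cu a; have := ob a; have := CK a; rewrite -/s /breadth => h1 h2 h3.
have : (s + 1) * (support_function C (a *m B^T) + dot a t) <=
       (s + 1) * support_function K a.
  by rewrite ler_wpM2l //; lra.
lra.
Qed.

(** From omega (1 + 1/s(K)) C ⊂_t omega (K - K) ⊂ C - C, where C stands for its affine
    image, cancel one copy of C.  The inequality is multiplied by s(K), and beta
    is what remains in front of the support function of C. *)
Lemma admissible_bound_inscribed C K omega :
  convex_body C -> convex_body K -> 0 < omega -> admissible C K omega ->
  omega * (asymmetry K + 1) * asymmetry C <= (asymmetry C + 1) * asymmetry K.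
Proof.
move=> bC bK om0 [B [t [CK ob]]].
have s1 := asymmetry_ge1 _ bC; set s := asymmetry C in s1 *.
have k1 := asymmetry_ge1 _ bK; set k := asymmetry K in k1 *.
have [u Ku] := asymmetry_fits _ bK; rewrite -/k in Ku.
(* For beta <= 0 the bound follows from s(C) <= s(C) + 1. *)
pose beta := omega * (k + 1) - k.
have [b0|b0] := leP beta 0; first by rewrite /beta in b0; nra.
have uB : B \in unitmx by exact: admissible_unit ob.
suff : s <= k / beta by rewrite ler_pdivlMr // /beta; nra.
have key : fits (fun a => support_function C (- (a *m B^T)))
                (fun a => support_function C (a *m B^T)) (k / beta).
  exists (beta^-1 *: (omega *: u - (beta + k) *: t)) => a.
  rewrite dotZr -(ler_pM2l b0) mulrDr mulrA mulfV ?gt_eqF // mul1r.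
  rewrite mulrA mulrCA mulfV ?gt_eqF // mulr1.
  rewrite dotDr dotNr !dotZr.
  have h1 := Ku a; have h2 := ob a; have h3 := CK (- a).
  rewrite mulNmx dotNl in h3; rewrite /breadth in h2.
  have := ler_wpM2l (ltW om0) h1.
  have : k * (omega * (support_function K a + support_function K (- a))) <=
         k * (support_function C (a *m B^T) + support_function C (- (a *m B^T))).
    by rewrite ler_wpM2l //; lra.
  have : omega * (k + 1) * (support_function C (- (a *m B^T)) - dot a t) <=
         omega * (k + 1) * support_function K (- a).
    by rewrite ler_wpM2l // mulr_ge0 ?ltW //; lra.
  rewrite /beta; lra.
have /(@fits_mulmx _ _ _ _ _ (invmx B^T)) [v Cv] := key.
apply: asymmetry_le => //; exists v => a; have := Cv a.
by rewrite mulmxKV // unitmx_tr.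
Qed.

End Bounds.

(** * The lower bound and its equality cases *)

Section LowerBound.
Context {R : realType} {n : nat}.
Hypothesis n_gt0 : (0 < n)%N.
Implicit Types (X Y C K : set 'rV[R]_n) (a b x p t v : 'rV[R]_n) (A B : 'M[R]_n).
Implicit Types (rho omega lambda : R).

(** Distributes the factor over the maximum, so that its two terms are the two
    bounds on admissible values. *)
Lemma lower_boundE C K : convex_body C -> convex_body K ->
  lower_bound K C =
  Num.max ((asymmetry K + 1) * asymmetry C / ((asymmetry C + 1) * asymmetry K))
          ((asymmetry K + 1) / (asymmetry C + 1)).
Proof.
move=> bC bK; have s1 := asymmetry_ge1 n_gt0 _ bC; have k1 := asymmetry_ge1 n_gt0 _ bK.
rewrite /lower_bound maxr_pMr ?mulr1; last by rewrite divr_ge0 //; lra.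
by rewrite mulrACA -invfM.
Qed.

Lemma lower_bound_le C K omega : convex_body C -> convex_body K -> 0 < omega ->
  admissible C K omega -> lower_bound K C <= omega^-1.
Proof.
move=> bC bK om0 aom; rewrite lower_boundE //.
have s1 := asymmetry_ge1 n_gt0 _ bC; have k1 := asymmetry_ge1 n_gt0 _ bK.
rewrite ge_max; apply/andP; split; rewrite -[leRHS]mul1r ler_pdivlMr //.
  rewrite mulrAC ler_pdivrMr ?mul1r ?mulr_gt0 //; try lra.
  by have := admissible_bound_inscribed n_gt0 _ _ _ bC bK om0 aom; lra.
rewrite mulrAC ler_pdivrMr ?mul1r; last lra.
by have := admissible_bound_circumscribed n_gt0 _ _ _ bC bK om0 aom; lra.
Qed.

Lemma support_difference C lambda a : convex_body C -> 0 <= lambda ->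
  support_function (minkowski_sum C (dilate (- lambda) C)) a =
  support_function C a + lambda * support_function C (- a).
Proof.
move=> bC l0; have cC := body_compact _ bC; have [c Cc] := body_nonempty _ bC.
rewrite support_minkowski //; [|by exists c| |by exists (- lambda *: c); exists c].
  by rewrite support_dilate scaleNr -scalerN supportZ //; exists c.
by rewrite dilateE; exact: linear_image_compact.
Qed.

Lemma convex_body_difference C lambda : convex_body C ->
  convex_body (minkowski_sum C (dilate (- lambda) C)).
Proof.
move=> bC; apply: convex_body_minkowski => //.
- by rewrite dilateE; apply: linear_image_compact; exact: body_compact.
- by rewrite dilateE; apply: linear_image_convex; exact: body_convex.
- by have [c Cc] := body_nonempty _ bC; exists (- lambda *: c); exists c.
Qed.

(** Both directions compare h_C(a) + lambda h_C(-a) with its reflection and collect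
    the terms in h_C(-a) on one side. *)
Lemma asymmetry_difference C lambda : convex_body C -> 0 <= lambda <= 1 ->
  asymmetry (minkowski_sum C (dilate (- lambda) C)) =
  (asymmetry C + lambda) / (1 + lambda * asymmetry C).
Proof.
move=> bC /andP[l0 l1]; set K := minkowski_sum _ _.
have bK : convex_body K by exact: convex_body_difference.
have hK a := support_difference _ _ a bC l0; rewrite -/K in hK.
have s1 := asymmetry_ge1 n_gt0 _ bC; set s := asymmetry C in s1 *.
have d0 : 0 < 1 + lambda * s by rewrite ltr_pwDl // mulr_ge0 //; lra.
apply/eqP; rewrite eq_le; apply/andP; split.
  have [t Ct] := asymmetry_fits n_gt0 _ bC; rewrite -/s in Ct.
  apply: asymmetry_le => //.
  exists (((1 - lambda ^+ 2) / (1 + lambda * s)) *: t) => a.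
  rewrite !hK opprK dotZr.
  set x := support_function C a; set y := support_function C (- a).
  have -> : y + lambda * x + (1 - lambda ^+ 2) / (1 + lambda * s) * dot a t =
      ((1 + lambda * s) * (y + lambda * x) + (1 - lambda ^+ 2) * dot a t) /
      (1 + lambda * s) by field; rewrite gt_eqF.
  rewrite mulrAC ler_pM2r ?invr_gt0 //.
  have l2 : 0 <= 1 - lambda ^+ 2 by nra.
  have := ler_wpM2l l2 (Ct a); rewrite -/x -/y; lra.
have k1 := asymmetry_ge1 n_gt0 _ bK; set k := asymmetry K in k1 *.
rewrite ler_pdivrMr //.
(* If k lambda >= 1 the coefficient of h_C(-a) is not positive, but then k is at
   least 1/lambda, which is no less than the
   claimed value. *)
have [lk|lk] := leP 1 (k * lambda).
  nra.
have [t Kt] := asymmetry_fits n_gt0 _ bK; rewrite -/k in Kt.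
have lk0 : 0 < 1 - k * lambda by lra.
suff : s <= (k - lambda) / (1 - k * lambda) by rewrite ler_pdivlMr //; nra.
apply: asymmetry_le => //; exists ((1 - k * lambda)^-1 *: t) => a.
rewrite dotZr -(ler_pM2l lk0) mulrDr mulrA mulfV ?gt_eqF // mul1r.
rewrite mulrA [_ * (_ / _)]mulrC divfK ?gt_eqF //.
by have := Kt a; rewrite !hK opprK; nra.
Qed.

(** Since -C contains a translate of (1/s(C)) C, the body K contains a translate of
    (1 + lambda/s(C)) C, while K - K = (1 + lambda)(C - C). *)
Lemma admissible_difference_left C lambda : convex_body C -> 0 <= lambda <= 1 ->
  let K := minkowski_sum C (dilate (- lambda) C) in
  exists2 omega, 0 < omega & admissible C K omega /\ omega^-1 <= lower_bound K C.
Proof.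
move=> bC l01 K; have [l0 l1] := andP l01.
have bK : convex_body K by exact: convex_body_difference.
have hK a := support_difference _ _ a bC l0; rewrite -/K in hK.
have s1 := asymmetry_ge1 n_gt0 _ bC; have k1 := asymmetry_ge1 n_gt0 _ bK.
have sK := asymmetry_difference _ _ bC l01; rewrite -/K in sK.
have [t Ct] := asymmetry_fits n_gt0 _ bC.
set s := asymmetry C in s1 sK Ct; set k := asymmetry K in k1 sK.
have s0 : 0 < s by lra.
have d0 : 0 < 1 + lambda * s by rewrite ltr_pwDl // mulr_ge0 //; lra.
pose mu := 1 + lambda / s.
have mu0 : 0 < mu by rewrite ltr_pwDl // divr_ge0 // ltW.
have muZ a : support_function C (a *m (mu%:M)^T) = mu * support_function C a.
  by rewrite tr_scalar_mx mul_mx_scalar supportZ ?ltW //;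
    [exact: body_compact|exact: body_nonempty].
have om0 : 0 < mu / (1 + lambda) by rewrite divr_gt0 //; lra.
exists (mu / (1 + lambda)) => //; split.
  exists mu%:M, (- (lambda / s) *: t); split=> a.
    rewrite muZ hK dotZr /mu.
    have ls0 : 0 <= lambda / s by rewrite divr_ge0 // ltW.
    have := ler_wpM2l ls0 (Ct (- a)).
    rewrite opprK dotNl mulrA divfK ?gt_eqF //; lra.
  rewrite {2}/breadth -mulNmx !muZ /breadth !hK opprK -mulrA -mulrDr ler_pM2l //.
  by rewrite mulrC ler_pdivrMr; lra.
rewrite lower_boundE // le_max; apply/orP; left.
rewrite -/s -/k sK /mu le_eqVlt; apply/orP; left; apply/eqP; field.
rewrite !gt_eqF //; lra.
Qed.

(** Since -K ⊂_t s(K) K, the body C lies in a translate of (1 + lambda s(K)) K, while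
    C - C = (1 + lambda)(K - K). *)
Lemma admissible_difference_right K lambda : convex_body K -> 0 <= lambda <= 1 ->
  let C := minkowski_sum K (dilate (- lambda) K) in
  exists2 omega, 0 < omega & admissible C K omega /\ omega^-1 <= lower_bound K C.
Proof.
move=> bK l01 C; have [l0 l1] := andP l01.
have bC : convex_body C by exact: convex_body_difference.
have hC a := support_difference _ _ a bK l0; rewrite -/C in hC.
have s1 := asymmetry_ge1 n_gt0 _ bC; have k1 := asymmetry_ge1 n_gt0 _ bK.
have sC := asymmetry_difference _ _ bK l01; rewrite -/C in sC.
have [t Kt] := asymmetry_fits n_gt0 _ bK.
set s := asymmetry C in s1 sC; set k := asymmetry K in k1 sC Kt.
have d0 : 0 < 1 + lambda * k by rewrite ltr_pwDl // mulr_ge0 //; lra.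
pose mu := (1 + lambda * k)^-1.
have mu0 : 0 < mu by rewrite invr_gt0.
have muZ a : support_function C (a *m (mu%:M)^T) = mu * support_function C a.
  by rewrite tr_scalar_mx mul_mx_scalar supportZ ?ltW //;
    [exact: body_compact|exact: body_nonempty].
have om0 : 0 < mu * (1 + lambda) by rewrite mulr_gt0 //; lra.
exists (mu * (1 + lambda)) => //; split.
  exists mu%:M, ((mu * lambda) *: t); split=> a.
    rewrite muZ hC dotZr -mulrA -mulrDr mulrC ler_pdivrMr //.
    have := ler_wpM2l l0 (Kt a); lra.
  rewrite {2}/breadth -mulNmx !muZ /breadth !hC opprK -mulrA -mulrDr ler_pM2l //.
  lra.
rewrite lower_boundE // le_max; apply/orP; right.
rewrite -/s -/k sC /mu le_eqVlt; apply/orP; left; apply/eqP; field.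
rewrite !gt_eqF //; lra.
Qed.

End LowerBound.

(** * The Grünbaum distance *)

Section Grunbaum.
Context {R : realType} {n : nat}.
Hypothesis n_gt0 : (0 < n)%N.
Implicit Types (X Y C K : set 'rV[R]_n) (a b x p t v : 'rV[R]_n) (A B : 'M[R]_n).
Implicit Types (rho omega : R).

(** Unlike [subset_t_dilateP] this allows a negative rho, as in the definition of
    the Grünbaum distance. *)
Lemma subset_t_dilate_support X C rho : convex_body X -> convex_body C ->
  subset_t X (dilate rho C) ->
  exists t, forall a, support_function X a + dot a t <= support_function C (rho *: a).
Proof.
move=> bX bC; have [c Cc] := body_nonempty _ bC.
rewrite subset_tP; [|exact: body_compact|exact: body_nonempty| | |]; last first.
- by exists (rho *: c); exists c.
- by rewrite dilateE; apply: linear_image_convex; exact: body_convex.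
- by rewrite dilateE; apply: linear_image_compact; exact: body_compact.
by move=> [t Xt]; exists t => a; have := Xt a; rewrite support_dilate.
Qed.

Lemma grunbaum_le K C A rho : A \in unitmx ->
  subset_t C (linear_image A K) -> subset_t (linear_image A K) (dilate rho C) ->
  grunbaum_distance K C <= `|rho|.
Proof.
move=> uA CK KC; apply: ge_inf; first by exists 0 => _ [r _ <-].
by exists rho => //; exists A.
Qed.

(** The set of factors |rho| is nonempty, as needed for a lower bound on an
    infimum in R: blow K up until it contains a translate of C, then C likewise. *)
Lemma le_grunbaum K C m : convex_body K -> convex_body C ->
  (forall A rho, A \in unitmx -> subset_t C (linear_image A K) ->
    subset_t (linear_image A K) (dilate rho C) -> m <= `|rho|) ->
  m <= grunbaum_distance K C.
Proof.
move=> bK bC lb; apply: lb_le_inf; last first.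
  by move=> _ [rho [A [uA CK KC]] <-]; exact: lb KC.
have [r r0 Cr] := compact_subset_t _ _ (body_compact _ bC) bK.
have urM : r%:M \in @unitmx R n.
  by rewrite unitmxE det_scalar unitfE expf_neq0 // gt_eqF.
have bKr := convex_body_linear_image _ _ urM bK.
have [s s0 Ks] := compact_subset_t _ _ (body_compact _ bKr) bC.
by exists `|s|, s => //; exists r%:M; split => //; rewrite -dilateE.
Qed.

Lemma le_grunbaum_admissible K C M : convex_body K -> convex_body C -> 0 < M ->
  is_max (admissible C K) M -> M^-1 <= grunbaum_distance K C.
Proof.
move=> bK bC M0 [_ Mmax]; apply: le_grunbaum => // A rho uA CK KC.
have bKA := convex_body_linear_image _ _ uA bK.
have [t Ct] := (subset_t_fits _ _ bC bKA).1 CK.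
have [u Ku] := subset_t_dilate_support _ _ _ bKA bC KC.
have bb a : breadth (linear_image A K) a <= `|rho| * breadth C a.
  rewrite -breadthZ; [|exact: body_compact|exact: body_nonempty].
  have := Ku a; have := Ku (- a); rewrite /breadth scalerN dotNl; lra.
have r0 : 0 < `|rho|.
  have := lt_le_trans (breadth_delta_gt0 n_gt0 _ bKA) (bb _).
  by rewrite pmulr_lgt0 // breadth_delta_gt0.
rewrite -[leRHS]invrK lef_pV2 ?posrE ?invr_gt0 //; apply: Mmax.
exists (invmx A), (t *m invmx A); split=> a.
  have := Ct (a *m (invmx A)^T).
  rewrite mul1r support_linear_image -mulmxA -trmx_mul mulmxV //.
  by rewrite trmx1 mulmx1 dot_mulmx.
have := bb (a *m (invmx A)^T).
rewrite breadth_linear_image -mulmxA -trmx_mul mulmxV // trmx1 mulmx1.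
by rewrite [_^-1 * _]mulrC ler_pdivrMr // mulrC.
Qed.

(** If C is symmetric and C ⊂_t AK ⊂_t rho C, then
    -AK ⊂_t |rho| C ⊂_t |rho| AK, and asymmetry is invariant under A. *)
Lemma asymmetry_le_grunbaum K C : convex_body K -> convex_body C ->
  centrally_symmetric C -> asymmetry K <= grunbaum_distance K C.
Proof.
move=> bK bC /(centrally_symmetric_support _ bC)[c Cc].
have hCZ k a : 0 <= k -> support_function C (k *: a) = k * support_function C a.
  by move=> k0; rewrite supportZ //; [exact: body_compact|exact: body_nonempty].
apply: le_grunbaum => // A rho uA CK KC.
have bKA := convex_body_linear_image _ _ uA bK.
have fCK := (subset_t_fits _ _ bC bKA).1 CK.
have fNC : fits (fun a => support_function C (- a)) (support_function C) 1.
  by exists (2 *: c) => a; rewrite dotZr mul1r; have := Cc a; lra.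
have fKC : fits (support_function (linear_image A K)) (support_function C) `|rho|.
  have [u Ku] := subset_t_dilate_support _ _ _ bKA bC KC.
  have [r0|r0] := ger0P rho; first by exists u => a; rewrite -hCZ.
  exists (u + (- rho) *: (2 *: c)) => a; have := Ku a.
  have -> : rho *: a = (- rho) *: (- a) by rewrite scaleNr scalerN opprK.
  have nr0 : 0 <= - rho by rewrite oppr_ge0 ltW.
  rewrite (hCZ _ _ nr0) dotDr !dotZr (Cc a); lra.
have := fits_trans _ _ _ _ _ (normr_ge0 rho) (fits_opp _ _ _ fKC)
  (fits_trans _ _ _ _ _ ler01 fNC fCK).
move=> /(@fits_mulmx _ _ _ _ _ ((invmx A)^T))[v Kv].
apply: asymmetry_le => //; exists v => a; have := Kv a.
rewrite !support_linear_image mulr1 mulr1 -mulNmx -!mulmxA -trmx_mul mulmxV //.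
by rewrite trmx1 !mulmx1.
Qed.

(** The optimal B of the extremal problem gives, with A = B^-1, the inclusion
    C ⊂_t AK and the comparison of breadths between AK and C; the last hypothesis
    turns the latter into the second inclusion. *)
Lemma grunbaum_eq K C M : convex_body K -> convex_body C -> 0 < M ->
  is_max (admissible C K) M ->
  (forall A rho, A \in unitmx -> 0 < rho ->
    (forall a, breadth (linear_image A K) a <= rho * breadth C a) ->
    subset_t (linear_image A K) (dilate rho C)) ->
  M^-1 = grunbaum_distance K C.
Proof.
move=> bK bC M0 Mmax bb; apply/eqP; rewrite eq_le le_grunbaum_admissible //=.
have [[B [t [CK ob]]] _] := Mmax.
have uB : B \in unitmx by exact: admissible_unit ob.
have uV : invmx B \in unitmx by rewrite unitmx_inv.
have VB a : a *m (invmx B)^T *m B^T = a.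
  by rewrite -mulmxA -trmx_mul mulmxV // trmx1 mulmx1.
have iM0 : 0 < M^-1 by rewrite invr_gt0.
rewrite -[leRHS](gtr0_norm iM0); apply: (grunbaum_le _ _ _ _ uV).
  apply/subset_t_fits => //; first exact: convex_body_linear_image.
  exists (t *m invmx B) => a; have := CK (a *m (invmx B)^T).
  by rewrite mul1r VB support_linear_image dot_mulmx.
apply: bb => // a; rewrite breadth_linear_image.
have := ob (a *m (invmx B)^T); rewrite VB.
by rewrite [M^-1 * _]mulrC ler_pdivlMr // mulrC.
Qed.

(** The support function of a symmetric body is half its breadth plus a linear form,
    and linear forms only translate. *)
Lemma symmetric_subset_t K C A rho : convex_body K -> convex_body C ->
  centrally_symmetric K -> centrally_symmetric C -> A \in unitmx -> 0 < rho ->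
  (forall a, breadth (linear_image A K) a <= rho * breadth C a) ->
  subset_t (linear_image A K) (dilate rho C).
Proof.
move=> bK bC /(centrally_symmetric_support _ bK)[c Kc].
move=> /(centrally_symmetric_support _ bC)[d Cd] uA r0 bb.
apply/subset_t_dilateP => //; [exact: convex_body_linear_image|exact: ltW|].
exists (rho *: d - c *m A) => a; have := bb a.
rewrite /breadth !support_linear_image mulNmx dotDr dotNr dotZr dot_mulmx.
have := Kc (a *m A^T); have := Cd a; nra.
Qed.

(** A parallelotope is cut out by n strips, so only the breadths of X in the n
    directions normal to the strips matter. *)
Lemma parallelotope_subset_t X C rho : convex_body X -> parallelotope C -> 0 < rho ->
  (forall a, breadth X a <= rho * breadth C a) -> subset_t X (dilate rho C).
Proof.
move=> bX [P [t0 [uP ->]]] r0 bb.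
set cube := [set x : 'rV[R]_n | forall i, 0 <= x 0 i <= 1] in bb *.
have cX := body_compact _ bX; have X0 := body_nonempty _ bX.
(* e i is the normal of the i-th strip: the functional that returns the i-th
   coordinate in the frame of P. *)
pose e i : 'rV[R]_n := delta_mx 0 i *m (invmx P)^T.
have dote i x : dot (e i) x = (x *m invmx P) 0 i.
  by rewrite -dot_mulmx dot_delta.
(* l translates X so that in every coordinate its minimum is 0. *)
pose l : 'rV[R]_n := \row_i support_function X (- e i).
have be i : breadth (translate t0 (linear_image P cube)) (e i) <= 1.
  have cube0 : translate t0 (linear_image P cube) !=set0.
    exists (0 *m P + t0), (0 *m P) => //; exists 0 => //.
    by move=> j; rewrite mxE lexx ler01.
  rewrite -[leRHS](addrK (dot (e i) t0)); apply: lerD; apply: support_le => //.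
    move=> _ [_ [y Cy <-] <-]; rewrite dotDr dote mulmxK // lerD2r.
    by have /andP[] := Cy i.
  move=> _ [_ [y Cy <-] <-]; rewrite dotNl dotDr dote mulmxK // opprD gerDr.
  by rewrite oppr_le0; have /andP[] := Cy i.
exists (l *m P + rho *: t0) => _ [x Xx <-].
exists (rho^-1 *: (x *m invmx P + l) *m P + t0); last first.
  rewrite scalerDr -scalemxAl scalerA divff ?gt_eqF // scale1r mulmxDl.
  by rewrite mulmxKV // addrA.
exists (rho^-1 *: (x *m invmx P + l) *m P) => //.
exists (rho^-1 *: (x *m invmx P + l)) => // i.
have lE : l 0 i = support_function X (- e i) by rewrite mxE.
have xE : (x *m invmx P) 0 i = dot (e i) x by rewrite dote.
rewrite mxE [in X in _ * X]mxE lE xE; apply/andP; split.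
  have := dot_le_support _ (- e i) _ cX Xx; rewrite dotNl => xl.
  by apply: mulr_ge0; [rewrite invr_ge0 ltW|lra].
rewrite mulrC ler_pdivrMr // mul1r.
apply: (@le_trans _ _ (breadth X (e i))).
  by rewrite /breadth lerD2r dot_le_support.
by apply: le_trans (bb _) _; rewrite -[leRHS]mulr1 ler_pM2l.
Qed.

End Grunbaum.

(** * Cut cubes *)

Section TruncatedCube.
Context {R : realType} {n : nat}.
Hypothesis n_gt0 : (0 < n)%N.
Implicit Types (d : R) (x : 'rV[R]_n).

(** A family that joins the cube (d = 1) to a simplex (d = n); the cut is placed so
    that the cube [0, 1/d]^n just fits. *)
Definition truncated_cube d : set 'rV[R]_n :=
  [set x | (forall i, 0 <= x 0 i <= 1) /\ \sum_i x 0 i <= n%:R / d].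

Lemma truncated_cube1 : truncated_cube 1 = [set x | forall i, 0 <= x 0 i <= 1].
Proof.
apply/seteqP; split=> [x []//|x xC]; split=> //.
rewrite divr1 -[n in n%:R]card_ord -sum1_card natr_sum.
by apply: ler_sum => i _; have /andP[] := xC i.
Qed.

Lemma small_mem_truncated_cube d x : 1 <= d ->
  (forall i, 0 <= x 0 i <= d^-1) -> truncated_cube d x.
Proof.
move=> d1 xd; have d0 : 0 < d by lra.
split=> [i|].
  have /andP[-> /= /le_trans] := xd i; apply; by rewrite invf_le1.
rewrite mulrC -[leRHS]mulrC -[n in n%:R]card_ord -sum1_card natr_sum mulr_suml.
by apply: ler_sum => i _; rewrite mul1r; have /andP[] := xd i.
Qed.

Lemma truncated_cube_body d : 1 <= d -> convex_body (truncated_cube d).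
Proof.
move=> d1; have d0 : 0 < d by lra.
split.
- apply: (@subclosed_compact _ _ [set x : 'rV[R]_n | `|x| <= 1]).
  + have -> : truncated_cube d =
      (\bigcap_(i in [set: 'I_n]) (fun x : 'rV[R]_n => x 0 i) @^-1` `[0, 1]) `&`
      (fun x : 'rV[R]_n => dot (const_mx 1) x) @^-1` [set y | y <= n%:R / d].
      have sE x : dot (const_mx 1) x = \sum_i x 0 i.
        by rewrite dotE; apply: eq_bigr => i _; rewrite mxE mul1r.
      apply/seteqP; split=> x [x01 xs]; split.
      - by move=> i _; rewrite /= in_itv /=; exact: x01.
      - by rewrite /= sE.
      - by move=> i; have := x01 i I; rewrite /= in_itv.
      - by move: xs; rewrite /= sE.
    apply: closedI.
      apply: closed_bigI => i _; apply: preimage_closed; last exact: interval_closed.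
      by move=> x _; exact: coord_continuous.
    apply: preimage_closed; last exact: closed_le.
    move=> x _.
    apply: (dot_continuous (cst (const_mx 1)) id) => y; last exact: cvg_id.
    exact: cst_continuous.
  + exact: mx_ball_compact.
  + move=> x [x01 _] /=; apply: mx_norm_le => // i j; rewrite ord1.
    by have /andP[x0 x1] := x01 j; rewrite ger0_norm.
- apply/convex_setP => x y k k0 k1 [x01 xs] [y01 ys]; split.
    move=> i; rewrite !mxE; have /andP[x0 x1] := x01 i; have /andP[y0 y1] := y01 i.
    apply/andP; split; nra.
  under eq_bigr do rewrite !mxE.
  rewrite big_split /= -!mulr_sumr; nra.
(* The centre of [0, 1/d]^n is an interior point. *)
- exists (const_mx (2 * d)^-1); apply/nbhs_ballP; exists (2 * d)^-1 => /=.
    by rewrite invr_gt0 mulr_gt0.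
  move=> x [_ xb]; apply: small_mem_truncated_cube => // i.
  have := xb 0 i; rewrite /ball /= mxE ltr_norml => /andP[h1 h2].
  have e : d^-1 = (2 * d)^-1 + (2 * d)^-1 by field; rewrite gt_eqF.
  by apply/andP; split; lra.
Qed.

(** Above: reflecting in the centre of the cube, [0,1/d]^n ⊂ K ⊂ [0,1]^n gives
    -K ⊂_t dK.  Below: if -K + t lies in rho K, then the standard basis vectors, which
    lie in K, force every t_i >= 1, and the point 0 of K puts t in rho K, so that
    n <= rho n / d. *)
Lemma truncated_cube_asymmetry d : 1 <= d <= n%:R -> asymmetry (truncated_cube d) = d.
Proof.
move=> /andP[d1 dn]; have d0 : 0 < d by lra.
have bK := truncated_cube_body _ d1.
have bNK : convex_body (dilate (-1) (truncated_cube d)).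
  by apply: convex_body_dilate => //; rewrite oppr_eq0 oner_eq0.
have [[r0 [t Kt]] rmin] : is_min [set rho | 0 <= rho /\
    subset_t (dilate (-1) (truncated_cube d)) (dilate rho (truncated_cube d))]
    (asymmetry (truncated_cube d)) by exact: circumradius_is_min.
apply/eqP; rewrite eq_le; apply/andP; split.
  apply: rmin; split; first exact: ltW.
  exists (const_mx 1) => _ [_ [x [x01 xs] <-] <-].
  exists (d^-1 *: (const_mx 1 - x)); last first.
    by rewrite scalerA divff ?gt_eqF // scale1r scaleN1r addrC.
  apply: small_mem_truncated_cube => // i; rewrite !mxE.
  have /andP[x0 x1] := x01 i.
  have dV0 : 0 <= d^-1 by rewrite invr_ge0 ltW.
  by apply/andP; split; [apply: mulr_ge0 => //|apply: ler_piMr => //]; lra.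
set r := asymmetry _ in r0 Kt *.
have nd1 : 1 <= n%:R / d by rewrite ler_pdivlMr ?mul1r.
have t1 i : 1 <= t 0 i.
  have [|y [y01 _] yE] := Kt (- delta_mx 0 i + t).
    exists (- delta_mx 0 i) => //; exists (delta_mx 0 i); last by rewrite scaleN1r.
    split=> [j|]; first by rewrite mxE eqxx /=; case: (j == i); rewrite ?lexx ?ler01.
    rewrite (bigD1 i) //= mxE !eqxx big1 ?addr0 // => j /negbTE ji.
    by rewrite mxE eqxx ji.
  have /andP[y0 _] := y01 i.
  have := congr1 (fun v : 'rV[R]_n => v 0 i) yE; rewrite !mxE !eqxx /=.
  have := mulr_ge0 r0 y0; lra.
have [|y [_ ys] yE] := Kt (0 + t).
  exists 0 => //; exists 0; last by rewrite scaler0.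
  split=> [j|]; first by rewrite mxE lexx ler01.
  by rewrite big1 ?(le_trans ler01) // => j _; rewrite mxE.
rewrite add0r in yE.
have nt : n%:R <= \sum_i t 0 i.
  rewrite -[n in n%:R]card_ord -sum1_card natr_sum.
  by apply: ler_sum => i _; exact: t1.
have : n%:R <= r * (n%:R / d).
  apply: le_trans nt _; rewrite -yE; under eq_bigr do rewrite mxE.
  by rewrite -mulr_sumr ler_wpM2l.
rewrite mulrA ler_pdivlMr // [r * _]mulrC ler_pM2l //.
by rewrite ltr0n.
Qed.

Lemma truncated_cube_symmetric : centrally_symmetric (truncated_cube 1).
Proof.
exists (const_mx 2^-1).
have sub x : truncated_cube 1 x -> truncated_cube 1 (const_mx 1 - x).
  rewrite truncated_cube1 => x01 i; rewrite !mxE; have /andP[x0 x1] := x01 i.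
  by apply/andP; split; lra.
have h : const_mx 1 = const_mx 2^-1 + const_mx 2^-1 :> 'rV[R]_n.
  by apply/rowP => i; rewrite !mxE; field.
apply/seteqP; split=> _ [x Cx <-]; exists (const_mx 1 - x); try exact: sub.
  by rewrite h; apply/rowP => i; rewrite !mxE; ring.
by rewrite h; apply/rowP => i; rewrite !mxE; ring.
Qed.

Lemma truncated_cube_parallelotope : parallelotope (truncated_cube 1).
Proof.
exists 1%:M, 0; split; first exact: unitmx1.
rewrite truncated_cube1; apply/seteqP; split=> [x x01|_ [_ [x x01 <-] <-]].
  by exists x; rewrite ?addr0 //; exists x; rewrite ?mulmx1.
by rewrite mulmx1 addr0.
Qed.

(** At most d by the inclusions [0,1]^n ⊂ dK ⊂ d[0,1]^n, at least d by the asymmetry. *)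
Lemma truncated_cube_grunbaum d : 1 <= d <= n%:R ->
  grunbaum_distance (truncated_cube d) (truncated_cube 1) = d.
Proof.
move=> /[dup] dn /andP[d1 _]; have d0 : 0 < d by lra.
have bK := truncated_cube_body _ d1; have bC := truncated_cube_body _ (lexx 1).
apply/eqP; rewrite eq_le; apply/andP; split; last first.
  rewrite -{1}(truncated_cube_asymmetry _ dn).
  by apply: asymmetry_le_grunbaum => //; exact: truncated_cube_symmetric.
have urM : d%:M \in @unitmx R n.
  by rewrite unitmxE det_scalar unitfE expf_neq0 // gt_eqF.
rewrite -[leRHS](gtr0_norm d0); apply: (grunbaum_le _ _ _ _ urM).
  exists 0 => _ [x [x01 _] <-]; rewrite addr0 -dilateE.
  exists (d^-1 *: x); last by rewrite scalerA divff ?gt_eqF // scale1r.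
  apply: small_mem_truncated_cube => // i; rewrite mxE; have /andP[x0 x1] := x01 i.
  have dV0 : 0 <= d^-1 by rewrite invr_ge0 ltW.
  by rewrite mulr_ge0 //= ler_piMr.
exists 0 => _ [_ [x [x01 _] <-] <-]; rewrite addr0 mul_mx_scalar.
by exists x => //; rewrite truncated_cube1.
Qed.

End TruncatedCube.

(** * The theorem *)

Section Assembly.
Context {R : realType} {n : nat}.
Hypothesis n_gt0 : (0 < n)%N.
Implicit Types (K C : set 'rV[R]_n).

(** Everything is read off the largest admissible value M.  An admissible omega
    with 1/omega at most the lower bound is squeezed: it forces equality. *)
Lemma body_pair_bounds K C : convex_body K -> convex_body C ->
  exists M m : R,
    [/\ is_max (width_ratios K C) M,
        is_min (diameter_ratios K C) m,
        [/\ lower_bound K C <= M^-1, M^-1 = m & m <= grunbaum_distance K C],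
        (exists2 lambda : R, 0 <= lambda <= 1 &
           K = minkowski_sum C (dilate (- lambda) C) \/
           C = minkowski_sum K (dilate (- lambda) K)) ->
          lower_bound K C = M^-1
      & (centrally_symmetric K /\ centrally_symmetric C) \/ parallelotope C ->
          m = grunbaum_distance K C].
Proof.
move=> bK bC; have [M M0 Mmax] := admissible_max n_gt0 _ _ bC bK.
have lbM : lower_bound K C <= M^-1 by apply: lower_bound_le => //; exact: Mmax.1.
have sharp omega : 0 < omega -> admissible C K omega ->
    omega^-1 <= lower_bound K C -> lower_bound K C = M^-1.
  move=> om0 /Mmax.2 omM omlb; apply/eqP; rewrite eq_le lbM /=.
  by apply: le_trans omlb; rewrite lef_pV2.
exists M, M^-1; split.
- exact: width_ratios_max.
- exact: diameter_ratios_min.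
- by split=> //; exact: le_grunbaum_admissible.
- move=> [lambda l01 [KE|CE]].
    have := admissible_difference_left n_gt0 _ _ bC l01; rewrite -KE.
    by move=> [omega om0 [aom]]; exact: sharp.
  have := admissible_difference_right n_gt0 _ _ bK l01; rewrite -CE.
  by move=> [omega om0 [aom]]; exact: sharp.
- move=> sym; apply: grunbaum_eq => // A rho uA rho0 bb.
  case: sym => [[sK sC]|pC]; first exact: symmetric_subset_t.
  by apply: parallelotope_subset_t => //; exact: convex_body_linear_image.
Qed.

(** Solve (c + lambda)/(1 + lambda c) = s for lambda.  The equation is degenerate
    only when s = c = 1. *)
Lemma exists_difference_asymmetry C s : convex_body C -> 1 <= s <= asymmetry C ->
  exists2 lambda : R, 0 <= lambda <= 1 &
    asymmetry (minkowski_sum C (dilate (- lambda) C)) = s.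
Proof.
move=> bC /andP[s1 sC]; set c := asymmetry C in sC.
have [c1|c1] := ltP 1 (s * c); last first.
  have -> : s = 1 by nra.
  exists 1; rewrite ?ler01 ?lexx // asymmetry_difference ?ler01 ?lexx // -/c.
  by rewrite mul1r addrC divff // gt_eqF //; nra.
have d0 : 0 < s * c - 1 by lra.
have l01 : 0 <= (c - s) / (s * c - 1) <= 1.
  by rewrite divr_ge0 ?ler_pdivrMr ?mul1r //=; nra.
exists ((c - s) / (s * c - 1)) => //.
rewrite asymmetry_difference // -/c; clearbody c.
have c_gt1 : 1 < c by nra.
by field; rewrite !gt_eqF //; nra.
Qed.

End Assembly.

Theorem theorem5p1 (R : realType) (n : nat) (n_gt0 : (0 < n)%N) :
  (forall K C : set 'rV[R]_n, convex_body K -> convex_body C ->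
    exists M m : R,
      [/\ is_max (width_ratios K C) M,
          is_min (diameter_ratios K C) m,
          [/\ lower_bound K C <= M^-1, M^-1 = m & m <= grunbaum_distance K C],
          (exists2 lambda : R, 0 <= lambda <= 1 &
             K = minkowski_sum C (dilate (- lambda) C) \/
             C = minkowski_sum K (dilate (- lambda) K)) ->
            lower_bound K C = M^-1
        & (centrally_symmetric K /\ centrally_symmetric C) \/ parallelotope C ->
            m = grunbaum_distance K C])
  /\ (forall s1 s2 : R, 1 <= s1 <= n%:R -> 1 <= s2 <= n%:R ->
        exists (K C : set 'rV[R]_n) (M : R),
          [/\ convex_body K /\ convex_body C, asymmetry K = s1, asymmetry C = s2,
              is_max (width_ratios K C) M & lower_bound K C = M^-1])
  /\ (forall d : R, 1 <= d <= n%:R ->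
        exists (K C : set 'rV[R]_n) (m : R),
          [/\ convex_body K /\ convex_body C, grunbaum_distance K C = d,
              is_min (diameter_ratios K C) m & m = grunbaum_distance K C]).
Proof.
split; first by move=> K C; exact: body_pair_bounds.
split=> [s1 s2 s1n s2n|d dn].
- have pair (s s' : R) : 1 <= s <= n%:R -> 1 <= s' <= s ->
      exists C : set 'rV[R]_n, exists2 lambda, 0 <= lambda <= 1 &
      [/\ convex_body C, asymmetry C = s &
          asymmetry (minkowski_sum C (dilate (- lambda) C)) = s'].
    move=> sn s's; have [s1' _] := andP sn; exists (truncated_cube s).
    have bC : convex_body (@truncated_cube R n s) by exact: truncated_cube_body.
    have sC : asymmetry (@truncated_cube R n s) = s by exact: truncated_cube_asymmetry.
    rewrite -sC in s's.
    have [lambda l01 aD] := exists_difference_asymmetry n_gt0 _ _ bC s's.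
    by exists lambda.
  (* The body with the larger asymmetry is the cut cube; the other one is a
     difference body of it. *)
  have [s12|s21] := leP s1 s2.
    have [|C [lambda l01 [bC sC sK]]] := pair s2 s1 s2n.
      by rewrite s12 andbT; case/andP: s1n.
    have bK := convex_body_difference _ lambda bC.
    have [M [m [Mmax _ _ eqM _]]] := body_pair_bounds n_gt0 _ _ bK bC.
    exists (minkowski_sum C (dilate (- lambda) C)), C, M; split=> //.
    by apply: eqM; exists lambda => //; left.
  have [|K [lambda l01 [bK sK sC]]] := pair s1 s2 s1n.
    by rewrite (ltW s21) andbT; case/andP: s2n.
  have bC := convex_body_difference _ lambda bK.
  have [M [m [Mmax _ _ eqM _]]] := body_pair_bounds n_gt0 _ _ bK bC.
  exists K, (minkowski_sum K (dilate (- lambda) K)), M; split=> //.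
  by apply: eqM; exists lambda => //; right.
- have [d1 _] := andP dn.
  have bK : convex_body (@truncated_cube R n d) by exact: truncated_cube_body.
  have bC : convex_body (@truncated_cube R n 1) by exact: truncated_cube_body.
  have [M [m [_ mmin _ _ eqm]]] := body_pair_bounds n_gt0 _ _ bK bC.
  exists (truncated_cube d), (truncated_cube 1), m; split=> //.
    exact: truncated_cube_grunbaum.
  by apply: eqm; right; exact: truncated_cube_parallelotope.
Qed.
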